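(* Let $f\in\mathbb{Z}[X]$ be a polynomial of degree $2$ or $3$. Then $G_f$ exists. Further, for every integer $k\geq G_f$ there are infinitely many integers $n\geq 0$ such that none of the integers $f(n+1),f(n+2),\dots,f(n+k)$ is coprime to all the others (i.e. for each $i\in\{1,\dots,k\}$ there is $j\in\{1,\dots,k\}$, $j\neq i$, with $\gcd(f(n+i),f(n+j))>1$).
   Context: For a polynomial $f\in\mathbb{Z}[X]$, consider the sequence $s(n)=f(n)$, $n\geq 1$. A block of consecutive terms $f(m+1),\dots,f(m+k)$ ($m\ge 0$) is said to have the property if none of them is coprime to all the others. $G_f$ denotes the smallest integer $G\geq 2$ such that for every integer $k\geq G$ one can find $k$ consecutive terms of this sequence having the property; ''$G_f$ exists'' means such an integer $G$ exists. *)

(* Defs.v *)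
From mathcomp Require Import all_boot all_order all_algebra.
Set Implicit Arguments. Unset Strict Implicit. Unset Printing Implicit Defensive.
Import Order.TTheory GRing.Theory Num.Theory.
Local Open Scope ring_scope.

Definition fval (f : {poly int}) (n : nat) : int := f.[n%:Z].

Definition block_prop (f : {poly int}) (k m : nat) : Prop :=
  forall i : nat, (1 <= i <= k)%N ->
    exists j : nat, [/\ (1 <= j <= k)%N, j != i &
      ~~ coprimez (fval f (m + i)) (fval f (m + j))].

Definition Gadmissible (f : {poly int}) (G : nat) : Prop :=
  (2 <= G)%N /\ forall k : nat, (G <= k)%N -> exists m : nat, block_prop f k m.

Definition is_Gf (f : {poly int}) (G : nat) : Prop :=
  Gadmissible f G /\ forall G' : nat, Gadmissible f G' -> (G <= G')%N.

(* Main.v *)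
Require Import Defs.
From mathcomp Require Import all_boot all_order all_algebra.
From mathcomp Require Import perm zify ring lra boolp reals sequences exp Rstruct.
Set Implicit Arguments. Unset Strict Implicit. Unset Printing Implicit Defensive.
Import Order.TTheory GRing.Theory Num.Theory.
Local Open Scope ring_scope.

(** A prime [p] dividing two values [f(n+i)], [f(n+j)] takes care of both
    positions, and the Chinese remainder theorem lets one prescribe [n] modulo
    finitely many primes independently.

    If [f] has a rational root, almost every prime has a root of [f] and the
    problem is that of covering [1..k] by one residue class for each prime
    [p <= k/2].  Removing the multiples of the primes in [(y, k/2^10]] leaves
    [O(k / log k)] integers (Chebyshev); a greedy choice of classes modulo the
    primes below the constant [y] divides this by an arbitrary constant, and
    each prime of [(k/2^10, k/2]] removes one of the survivors.

    If [f] is irreducible, a greedy choice of classes modulo finitely many small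
    primes having a root of [f] leaves at most [eps k] positions, because the
    sum of the inverses of such primes diverges.  Each survivor is covered by a
    prime larger than [k] modulo which [f] has two roots at distance [<= k/2].
    These primes divide values [H(t)], [t << k], of a polynomial [H] (the
    discriminant relation satisfied by a difference of two roots), and there are
    [>> k] of them: modulo the primes dividing [H(t)], [f] splits completely, so
    that the primes up to [T] account for only slightly more than half of
    [log |H(1) ... H(T)|]. *)

(** * Blocks from coverings *)

(** Degree at most 3 matters twice. A polynomial of degree 2 or 3 without a root in a field is
    irreducible there, so a prime modulo which [g] has no root divides the norm of an element of
    Z[X]/(g) only if it divides all the coordinates. Such primes weigh only 1/p^2, and counting the
    elements of a box by their norm forces the primes having a root to carry a divergent sum of 1/p,
    without prime ideals. Moreover, modulo p, one root difference satisfying the discriminant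
    relation determines all the roots rationally, under mild nonvanishing conditions, so prescribing
    it makes [g] split. This splitting is the crux. H may have deg H roots modulo p, and the sum of
    log p / p over all p <= K is about log K, so the primes up to K could a priori account for all
    of log |H(1) ... H(K)|. When a form of degree d splits modulo p, each of its d lattices x = r y
    catches its share of the differences of points of a box; this bounds the sum of log p / p over
    split primes by half of log K and leaves room for primes beyond K. *)

Lemma dvdz_horner_add (f : {poly int}) (p x y : int) :
  (p %| x - y)%Z -> (p %| f.[x] - f.[y])%Z.
Proof.
move=> pxy; elim/poly_ind: f => [|f c IH]; first by rewrite !horner0 subrr dvdz0.
rewrite !hornerMXaddC.
have -> : f.[x] * x + c - (f.[y] * y + c) = (f.[x] - f.[y]) * x + f.[y] * (x - y).
  by ring.
by apply: rpredD; [apply: dvdz_mulr | apply: dvdz_mull].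
Qed.

Lemma dvdz_horner_eqmod (f : {poly int}) (p x y : int) :
  (p %| x - y)%Z -> (p %| f.[x])%Z = (p %| f.[y])%Z.
Proof.
move=> /(dvdz_horner_add f) h.
by rewrite -[f.[x]](subrK f.[y]); apply: rpredDl.
Qed.

Lemma crt_seq (s : seq (nat * nat)) :
    uniq (unzip1 s) -> all prime (unzip1 s) ->
  exists m : nat, {in s, forall pc, m = pc.2 %[mod pc.1]}.
Proof.
elim: s => [|[p c] s IH] /=; first by move=> _ _; exists 0%N.
move=> /andP[ps us] /andP[pp prs].
have [m Hm] := IH us prs.
pose M := (\prod_(q <- unzip1 s) q)%N.
have cop : coprime p M.
  rewrite /M prime_coprime //; apply/negP.
  elim: (unzip1 s) ps prs => [|q t IHt] /=.
    by rewrite big_nil dvdn1 => _ _ /eqP p1; rewrite p1 in pp.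
  rewrite inE negb_or big_cons => /andP[npq nt] /andP[qp tp].
  rewrite Euclid_dvdM // => /orP[|]; last by apply: IHt.
  by rewrite dvdn_prime2 // (negPf npq).
exists (chinese p M c m) => -[q e]; rewrite inE => /orP[/eqP[-> ->]|qs] /=.
  by rewrite chinese_modl.
have qM : (q %| M)%N.
  rewrite /M; have: q \in unzip1 s by apply/mapP; exists (q, e).
  elim: (unzip1 s) => // a t IHt; rewrite inE big_cons => /orP[/eqP->|/IHt].
    exact: dvdn_mulr.
  exact: dvdn_mull.
have := chinese_modr cop c m; move/(congr1 (modn^~ q)).
by rewrite !modn_dvdm // => ->; apply: (Hm _ qs).
Qed.

Lemma common_prime_not_coprimez (p : nat) (x y : int) :
  prime p -> (p%:Z %| x)%Z -> (p%:Z %| y)%Z -> ~~ coprimez x y.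
Proof.
move=> pp px py; apply/negP => /eqP cxy.
have : (p%:Z %| gcdz x y)%Z by rewrite dvdz_gcd px py.
by rewrite cxy dvdz1 /= => /eqP p1; rewrite p1 in pp.
Qed.

Lemma not_coprimez_prime (x y : int) :
  ~~ coprimez x y -> exists p : nat, [/\ prime p, (p%:Z %| x)%Z & (p%:Z %| y)%Z].
Proof.
rewrite /coprimez => h.
have : (pdiv `|gcdz x y| %| `|gcdz x y|)%N by apply: pdiv_dvd.
have [g0|gn0] := eqVneq (gcdz x y) 0.
  move/eqP: g0; rewrite gcdz_eq0 => /andP[/eqP-> /eqP->] _.
  (* Both values are 0 here, and any prime serves. *)
  by exists 2; rewrite !dvdz0.
have g1 : (1 < `|gcdz x y|)%N by move: h gn0; rewrite /gcdz; case: (gcdn _ _) => [|[|n]].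
move=> hd; exists (pdiv `|gcdz x y|); rewrite pdiv_prime //.
have hd' : ((pdiv `|gcdz x y|)%:Z %| gcdz x y)%Z by rewrite /dvdz.
by split=> //; apply: (dvdz_trans hd'); rewrite ?dvdz_gcdl ?dvdz_gcdr.
Qed.

(** Whether p divides f(m + i) depends only on m modulo p. Each pair (p, c) therefore states its
    demand at [c], and the Chinese remainder theorem supplies one m congruent to every c. *)
Lemma block_of_cover (f : {poly int}) (k : nat) (s : seq (nat * nat)) :
    uniq (unzip1 s) -> all prime (unzip1 s) ->
    (forall i, (1 <= i <= k)%N -> exists2 pc, pc \in s & exists j,
       [/\ (1 <= j <= k)%N, j != i, (pc.1%:Z %| f.[(pc.2 + i)%:Z])%Z
         & (pc.1%:Z %| f.[(pc.2 + j)%:Z])%Z]) ->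
  exists m, block_prop f k m.
Proof.
move=> us ps cov; have [m Hm] := crt_seq us ps; exists m => i ik.
have [[p c] pcs [j [jk ji pi pj]]] := cov i ik; exists j; split=> //.
have pp : prime p by apply: (allP ps); apply/mapP; exists (p, c).
have mc (l : nat) : (p%:Z %| (m + l)%:Z - (c + l)%:Z)%Z.
  have := Hm _ pcs => /= mc.
  have -> : (m + l)%:Z - (c + l)%:Z = m%:Z - c%:Z by lia.
  by rewrite -eqz_mod_dvd; apply/eqP; rewrite !modz_nat mc.
apply: (common_prime_not_coprimez pp); rewrite /fval.
  by rewrite (dvdz_horner_eqmod f (mc i)).
by rewrite (dvdz_horner_eqmod f (mc j)).
Qed.

(** One witness prime per position suffices, so translating m by multiples of the product of these
    primes preserves the property. A single block thus gives infinitely many. *)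
Lemma block_periodic (f : {poly int}) (k m : nat) :
  block_prop f k m -> forall N, exists n, (N <= n)%N /\ block_prop f k n.
Proof.
move=> bm N.
pose P i p := [/\ prime p & exists j, [/\ (1 <= j <= k)%N, j != i,
   (p%:Z %| fval f (m + i))%Z & (p%:Z %| fval f (m + j))%Z]].
have [s ps] : exists s : seq nat, all prime s /\
    forall i, (1 <= i <= k)%N -> exists2 p, p \in s & P i p.
  suff H n : exists s : seq nat, all prime s /\
    forall i, (1 <= i <= k)%N -> (i < n)%N -> exists2 p, p \in s & P i p.
    have [s [s1 s2]] := H k.+1; exists s; split=> // i ik; apply: s2 => //; lia.
  elim: n => [|n [s [s1 s2]]]; first by exists [::].
  case nk : (1 <= n <= k)%N; last first.
    exists s; split=> // i ik; rewrite ltnS leq_eqVlt => /orP[/eqP ein|]; last exact: s2.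
    by rewrite -ein ik in nk.
  have [j [jk jn /not_coprimez_prime[p [pp p1 p2]]]] := bm _ nk.
  exists (p :: s); split; first by rewrite /= pp.
  move=> i ik; rewrite ltnS leq_eqVlt => /orP[/eqP ->|/(s2 _ ik)[q qs Pq]].
    by exists p; rewrite ?mem_head //; split=> //; exists j.
  by exists q => //; rewrite inE qs orbT.
case: ps => sp cov.
pose M := (\prod_(p <- s) p)%N.
have M0 : (0 < M)%N.
  rewrite /M big_seq_cond prodn_cond_gt0 // => p /andP[/(allP sp)/prime_gt0].
  by [].
exists (m + N * M)%N; split; first by nia.
move=> i ik; have [p psm [pp [j [jk ji p1 p2]]]] := cov i ik.
exists j; split=> //.
have pM : (p %| M)%N.
  rewrite /M; elim: (s) psm => // a t IHt; rewrite inE big_cons => /orP[/eqP->|/IHt].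
    exact: dvdn_mulr.
  exact: dvdn_mull.
have mc (l : nat) : (p%:Z %| (m + N * M + l)%:Z - (m + l)%:Z)%Z.
  have -> : (m + N * M + l)%:Z - (m + l)%:Z = N%:Z * M%:Z by lia.
  by apply: dvdz_mull.
by apply: (common_prime_not_coprimez pp); rewrite /fval (dvdz_horner_eqmod f (mc _)).
Qed.

(** * Greedy choice of residue classes *)

Lemma greedy_class (p : nat) (U : seq nat) : (0 < p)%N ->
  exists2 e, (e < p)%N &
    (size [seq i <- U | (i %% p != e)%N] * p <= size U * p.-1)%N.
Proof.
move=> p0.
have tot : (\sum_(e < p) count (fun i => i %% p == e)%N U = size U)%N.
  elim: U => [|i U IH] /=; first by rewrite big1.
  rewrite big_split /= IH (bigD1 (Ordinal (ltn_pmod i p0))) //= eqxx.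
  rewrite big1 ?addn0 // => e; rewrite -val_eqE /= eq_sym => /negPf -> //.
suff [e he] : exists e : 'I_p, (size U <= count (fun i => i %% p == e)%N U * p)%N.
  exists e => //; rewrite size_filter.
  have := count_predC (fun i => i %% p == e)%N U.
  have -> : count (predC (fun i => i %% p == e)%N) U = count (fun i => (i %% p)%N != e) U.
    by apply: eq_count.
  case: p p0 e tot he => // p _ e _ /=; nia.
apply/existsP; apply/contraT; rewrite negb_exists => /forallP H.
have U0 : (0 < size U)%N by have := H (Ordinal p0); lia.
have : (\sum_(e < p) count (fun i => i %% p == e)%N U * p < \sum_(e < p) size U)%N.
  rewrite (bigD1 (Ordinal p0)) //= [X in (_ < X)%N](bigD1 (Ordinal p0)) //=.
  rewrite -addSn leq_add //; first by have := H (Ordinal p0); rewrite -ltnNge.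
  by apply: leq_sum => e _; have := H e; lia.
by rewrite -big_distrl /= tot sum_nat_const card_ord mulnC ltnn.
Qed.

(** Dropping the most frequent class modulo each prime in turn keeps at most the proportion 1 - 1/p;
    the product of these is written with cleared denominators. *)
Lemma greedy (S U : seq nat) : all prime S ->
  exists s : seq (nat * nat), [/\ unzip1 s = S, all (fun pe => pe.2 < pe.1)%N s &
    (size [seq i <- U | all (fun pe => i %% pe.1 != pe.2)%N s] * \prod_(p <- S) p
       <= size U * \prod_(p <- S) p.-1)%N].
Proof.
elim: S => [|p S IH] /=.
  by move=> _; exists [::]; rewrite !big_nil /= filter_predT.
move=> /andP[/prime_gt0 p0 /IH [s [<- s1 s2]]].
have [e ep He] := greedy_class [seq i <- U | all (fun pe => i %% pe.1 != pe.2)%N s] p0.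
exists ((p, e) :: s) => /=; rewrite ep; split=> //.
rewrite !big_cons -filter_predI in He *.
set a := size _ in He *; set b := size _ in He s2.
have le1 := leq_mul He (leqnn (\prod_(p <- unzip1 s) p)%N).
have le2 := leq_mul s2 (leqnn p.-1).
by rewrite mulnA (leq_trans le1) // mulnAC (leq_trans le2) // -mulnA (mulnC _ p.-1).
Qed.

Lemma label_seq (A B : eqType) (P : A -> B -> Prop) (s : seq A) :
    (forall x, x \in s -> exists y, P x y) ->
  exists t : seq (A * B), unzip1 t = s /\ {in t, forall z, P z.1 z.2}.
Proof.
elim: s => [|x s IH] H; first by exists [::].
have [|t [<- Ht]] := IH; first by move=> y ys; apply: H; rewrite inE ys orbT.
have [y Pxy] := H x (mem_head _ _).
exists ((x, y) :: t); split=> // z; rewrite inE => /orP[/eqP-> //|]; exact: Ht.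
Qed.

Definition has_root_mod (f : {poly int}) (p : nat) := exists r : nat, (p%:Z %| f.[r%:Z])%Z.

(** The bound [2 * d <= k] ensures that each i in 1..k has i + d or i - d in the block, so that such
    a prime can serve any single position. *)
Definition has_root_pair_mod (f : {poly int}) (k p : nat) := exists r d : nat,
  [/\ (0 < d)%N, (2 * d <= k)%N, (p%:Z %| f.[r%:Z])%Z & (p%:Z %| f.[(r + d)%:Z])%Z].

Lemma dvdz_horner_modn (f : {poly int}) (p a b : nat) :
  a = b %[mod p] -> (p%:Z %| f.[a%:Z])%Z = (p%:Z %| f.[b%:Z])%Z.
Proof.
by move=> ab; apply: dvdz_horner_eqmod; rewrite -eqz_mod_dvd !modz_nat ab.
Qed.

(** Three kinds of primes cooperate: those of [S0] cover their multiples, those of [S1] a greedily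
    chosen class of what is left, and each prime of [Q] one remaining position. The numerical
    hypothesis guarantees that at most [size Q] positions survive the first two stages. *)
Lemma block_of_classes (f : {poly int}) (k : nat) (S0 S1 Q : seq nat) :
    uniq (S0 ++ S1 ++ Q) -> all prime (S0 ++ S1 ++ Q) ->
    {in S0 ++ S1, forall p, has_root_mod f p /\ (2 * p <= k)%N} ->
    {in Q, forall p, has_root_pair_mod f k p} ->
    (size [seq i <- iota 1 k | all (fun p => ~~ (p %| i)) S0] * \prod_(p <- S1) p.-1
       <= size Q * \prod_(p <- S1) p)%N ->
  exists m, block_prop f k m.
Proof.
move=> us ps rts prs hU.
have := ps; rewrite !all_cat => /and3P[ps0 ps1 psQ].
set U0 := [seq i <- _ | _] in hU.
have [s1 [us1 es1 hs1]] := greedy U0 ps1.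
set U1 := [seq i <- U0 | _] in hs1.
have szU : (size U1 <= size Q)%N.
  have P0 : (0 < \prod_(p <- S1) p)%N.
    by rewrite big_seq_cond prodn_cond_gt0 // => p /andP[/(allP ps1)/prime_gt0].
  by rewrite -(leq_pmul2r P0); apply: leq_trans hs1 hU.
(* Since 2 p <= k, one of i + p and i - p stays in the block. *)
have step (p i : nat) : prime p -> (2 * p <= k)%N -> (1 <= i <= k)%N ->
    exists j, [/\ (1 <= j <= k)%N, j != i & j = i %[mod p]].
  move=> /prime_gt0 p0 pk ik; have [h|h] := leqP (i + p) k.
    by exists (i + p)%N; split; [clear -ik h p0 pk; lia | clear -ik h p0 pk; lia | rewrite modnDr].
  exists (i - p)%N; split; [clear -ik h p0 pk; lia | clear -ik h p0 pk; lia |].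
  by rewrite -[in RHS](@subnK p i) ?modnDr //; lia.
have [t0 [ut0 Ht0]] : exists t0 : seq (nat * nat), unzip1 t0 = S0 /\ {in t0, forall z,
    forall i, (z.1 %| i)%N -> (z.1%:Z %| f.[(z.2 + i)%:Z])%Z}.
  apply: (label_seq (P := fun p c => forall i : nat, (p %| i)%N -> (p%:Z %| f.[(c + i)%:Z])%Z)).
  move=> p pS; have [|[r Hr] _] := rts p; first by rewrite mem_cat pS.
  exists r => i pi; rewrite (dvdz_horner_modn f (b := r)) //.
  by rewrite -modnDmr (eqP pi) addn0.
have [t1 [ut1 Ht1]] : exists t1 : seq ((nat * nat) * nat), unzip1 t1 = s1 /\ {in t1, forall z,
    forall i, (i %% z.1.1 = z.1.2)%N -> (z.1.1%:Z %| f.[(z.2 + i)%:Z])%Z}.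
  apply: (label_seq (P := fun pe c => forall i : nat, (i %% pe.1 = pe.2)%N ->
     (pe.1%:Z %| f.[(c + i)%:Z])%Z)).
  move=> [p e] pS /=; have pS1 : p \in S1 by rewrite -us1; apply/mapP; exists (p, e).
  have [|[r Hr] _] := rts p; first by rewrite mem_cat pS1 orbT.
  have ep : (e < p)%N := allP es1 _ pS.
  (* [p - e] stands for -e, so that c + i is congruent to r for i in the class e. *)
  exists (r + (p - e))%N => i ie; rewrite (dvdz_horner_modn f (b := r)) //.
  by rewrite -modnDmr ie -addnA subnK ?modnDr // ltnW.
(* The zip hands a different prime of [Q] to each survivor. *)
have [tQ [utQ HtQ]] : exists tQ : seq ((nat * nat) * nat),
   unzip1 tQ = zip (take (size U1) Q) U1 /\ {in tQ, forall z,
    exists j, [/\ (1 <= j <= k)%N, j != z.1.2, (z.1.1%:Z %| f.[(z.2 + z.1.2)%:Z])%Z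
      & (z.1.1%:Z %| f.[(z.2 + j)%:Z])%Z]}.
  apply: (label_seq (P := fun qi c => exists j, [/\ (1 <= j <= k)%N, j != qi.2,
     (qi.1%:Z %| f.[(c + qi.2)%:Z])%Z & (qi.1%:Z %| f.[(c + j)%:Z])%Z])).
  move=> [q i] qiz /=.
  have qQ : q \in Q.
    apply: (@mem_take (size U1)); have := map_f fst qiz.
    by rewrite [map _ _]unzip1_zip // size_takel.
  have iU : i \in U1.
    by have := map_f snd qiz; rewrite [map _ _]unzip2_zip // size_takel.
  have q0 : (0 < q)%N by apply: prime_gt0; apply: (allP psQ).
  have ik : (1 <= i <= k)%N.
    by move: iU; rewrite !mem_filter mem_iota add1n ltnS => /and3P[].
  (* [i * q.-1] represents -i modulo q without subtraction. It moves position i onto the root r, or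
     onto r + d when the partner has to be i - d. *)
  have iq : (i * q.-1 + i = i * q)%N by rewrite addnC -mulnS prednK.
  have [r [d [d0 dk h1 h2]]] := prs q qQ.
  have [h|h] := leqP (i + d) k.
    exists (r + i * q.-1)%N, (i + d)%N; split; [clear -ik h d0 dk; lia | clear -ik h d0 dk; lia | |].
      rewrite (dvdz_horner_modn f (b := r)) //.
      by have -> : (r + i * q.-1 + i = i * q + r)%N; [clear -iq ik h dk; lia | rewrite modnMDl].
    rewrite (dvdz_horner_modn f (b := (r + d)%N)) //.
    by have -> : (r + i * q.-1 + (i + d) = i * q + (r + d))%N; [clear -iq ik h dk; lia | rewrite modnMDl].
  exists (r + d + i * q.-1)%N, (i - d)%N; split; [clear -ik h d0 dk; lia | clear -ik h d0 dk; lia | |].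
    rewrite (dvdz_horner_modn f (b := (r + d)%N)) //.
    by have -> : (r + d + i * q.-1 + i = i * q + (r + d))%N; [clear -iq ik h dk; lia | rewrite modnMDl].
  rewrite (dvdz_horner_modn f (b := r)) //.
  by have -> : (r + d + i * q.-1 + (i - d) = i * q + r)%N; [clear -iq ik h dk; lia | rewrite modnMDl].
pose s := t0 ++ [seq (z.1.1, z.2) | z <- t1] ++ [seq (z.1.1, z.2) | z <- tQ].
have us' : unzip1 s = S0 ++ S1 ++ take (size U1) Q.
  rewrite /s /unzip1 !map_cat -!map_comp -/(unzip1 t0) ut0; congr (_ ++ (_ ++ _)).
    by rewrite -us1 -ut1 /unzip1 -map_comp; apply: eq_map.
  rewrite -[RHS](@unzip1_zip _ _ _ U1) ?size_takel //.
  by rewrite -utQ /unzip1 -map_comp; apply: eq_map.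
have := @block_of_cover f k s; rewrite us'; apply.
- have sQ : subseq (take (size U1) Q) Q by apply: take_subseq.
  by apply: (subseq_uniq _ us); rewrite !cat_subseq.
- rewrite !all_cat ps0 ps1 /=; apply/allP => q /mem_take; exact: (allP psQ).
move=> i ik.
case i0 : (all (fun p => ~~ (p %| i)%N) S0); last first.
  move/negbT: i0; rewrite -has_predC => /hasP[p pS /= /negPn pi].
  move: (pS); rewrite -ut0 => /mapP[[q c] qc /= pq].
  rewrite -{q}pq in qc.
  exists (p, c); first by rewrite /s mem_cat qc.
  have [|_ pk] := rts p; first by rewrite mem_cat pS.
  have [j [jk ji je]] := step _ _ (allP ps0 _ pS) pk ik.
  by exists j; split=> //=; apply: (Ht0 _ qc) => //=; rewrite /dvdn ?je.
case i1 : (all (fun pe => i %% pe.1 != pe.2)%N s1); last first.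
  move/negbT: i1; rewrite -has_predC => /hasP[[p e] pS /= /negPn/eqP pi].
  move: (pS); rewrite -ut1 => /mapP[[q c] qc /= pq]; rewrite -{q}pq in qc.
  exists (p, c).
    by rewrite /s !mem_cat; apply/orP; right; apply/orP; left; apply/mapP; exists ((p, e), c).
  have pS1 : p \in S1 by rewrite -us1; apply/mapP; exists (p, e).
  have [|_ pk] := rts p; first by rewrite mem_cat pS1 orbT.
  have [j [jk ji je]] := step _ _ (allP ps1 _ pS1) pk ik.
  by exists j; split=> //=; apply: (Ht1 _ qc) => //=; rewrite ?je.
have iU : i \in U1 by rewrite !mem_filter i1 i0 mem_iota add1n ltnS.
pose q := nth 0%N (take (size U1) Q) (index i U1).
have qi : (q, i) \in zip (take (size U1) Q) U1.
  have sz : size (take (size U1) Q) = size U1 by rewrite size_takel.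
  have -> : (q, i) = nth (0%N, 0%N) (zip (take (size U1) Q) U1) (index i U1).
    by rewrite nth_zip // nth_index.
  by apply: mem_nth; rewrite size_zip sz minnn index_mem.
move: qi; rewrite -utQ => /mapP[[qi c] qc /= eqi]; rewrite -{qi}eqi in qc.
have [j Hj] := HtQ _ qc.
exists (q, c); last by exists j.
by rewrite /s !mem_cat; apply/orP; right; apply/orP; right; apply/mapP; exists ((q, i), c).
Qed.

(** * Chebyshev's bounds *)

Local Open Scope nat_scope.

Definition primes_upto (n : nat) := [seq p <- iota 1 n | prime p].

Lemma mem_primes_upto n p : (p \in primes_upto n) = prime p && (p <= n).
Proof.
rewrite mem_filter mem_iota add1n ltnS; case pp : (prime p) => //=.
by rewrite prime_gt0.
Qed.

Lemma primes_upto_uniq n : uniq (primes_upto n).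
Proof. by rewrite filter_uniq ?iota_uniq. Qed.

Lemma coprime_prod_primes p (s : seq nat) :
  prime p -> all prime s -> p \notin s -> coprime p (\prod_(q <- s) q).
Proof.
move=> pp; elim: s => [|q s IH] /=; first by rewrite big_nil coprimen1.
move=> /andP[pq /IH {}IH]; rewrite inE negb_or big_cons => /andP[npq /IH].
by rewrite coprimeMr => ->; rewrite prime_coprime // dvdn_prime2 // npq.
Qed.

Lemma prod_primes_dvdn (s : seq nat) m :
  uniq s -> all prime s -> {in s, forall p, p %| m} -> \prod_(p <- s) p %| m.
Proof.
elim: s => [|p s IH] /=; first by rewrite big_nil.
move=> /andP[ps us] /andP[pp prs] H; rewrite big_cons Gauss_dvd ?coprime_prod_primes //.
by rewrite H ?mem_head // IH // => q qs; apply: H; rewrite inE qs orbT.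
Qed.

Lemma sum_bin n : \sum_(i < n.+1) 'C(n, i) = 2 ^ n.
Proof.
by rewrite (expnDn 1 1); apply: eq_bigr => i _; rewrite !exp1n !muln1.
Qed.

Lemma bin_odd_mid m : 'C(m.*2.+1, m) <= 4 ^ m.
Proof.
have e : 'C(m.*2.+1, m.+1) = 'C(m.*2.+1, m).
  by rewrite -bin_sub; [congr ('C(_, _)); lia | lia].
have : 2 * 'C(m.*2.+1, m) <= 2 ^ m.*2.+1.
  have lt1 : m < m.*2.+2 by lia.
  have lt2 : m.+1 < m.*2.+2 by lia.
  rewrite -sum_bin (bigD1 (Ordinal lt1)) //= (bigD1 (Ordinal lt2)) /=; last first.
    by rewrite -val_eqE /=; lia.
  by rewrite e; lia.
by rewrite expnS -mul2n expnM leq_pmul2l.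
Qed.

(** For n = 2 m + 1, the primes in (m + 1, 2 m + 1] all divide a middle binomial coefficient, which
    is at most 4 ^ m; strong induction handles the primes up to m + 1. *)
Lemma primorial_le n : \prod_(p <- primes_upto n) p <= 4 ^ n.
Proof.
elim/ltn_ind: n => n IH.
case: (leqP n 2) => [|n2].
  by case: n {IH} => [|[|[|n]]] //= _; rewrite /primes_upto /= ?big_cons ?big_nil.
have [nodd|neven] := boolP (odd n); last first.
  have -> : primes_upto n = primes_upto n.-1.
    rewrite /primes_upto -[in iota 1 n](prednK (n := n)); last by lia.
    have -> : n.-1.+1 = n.-1 + 1 by rewrite addn1.
    rewrite iotaD filter_cat /= ifN ?cats0 //.
    apply/negP => /even_prime[]; lia.
  by apply: (leq_trans (IH n.-1 _)); rewrite ?leq_exp2l; lia.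
pose m := n./2; have nm : n = m.*2.+1 by rewrite -[n]odd_double_half nodd.
have -> : primes_upto n = primes_upto m.+1 ++ [seq p <- iota m.+2 m | prime p].
  by rewrite /primes_upto -filter_cat -(iotaD 1 m.+1 m) nm; congr (filter _ (iota _ _)); lia.
rewrite big_cat /= nm.
have -> : 4 ^ m.*2.+1 = 4 ^ m.+1 * 4 ^ m by rewrite -expnD; congr (4 ^ _); lia.
rewrite leq_mul //; first by apply: IH; lia.
apply: (leq_trans _ (bin_odd_mid m)); apply: dvdn_leq; first by rewrite bin_gt0; lia.
apply: prod_primes_dvdn; rewrite ?filter_uniq ?iota_uniq ?filter_all //.
move=> p; rewrite mem_filter mem_iota => /andP[pp hp].
have hm : m <= m.*2.+1 by lia.
have : p %| m.*2.+1`! by apply: dvdn_fact; lia.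
rewrite -(bin_fact hm) Euclid_dvdM // Euclid_dvdM //.
have nf l : l < p -> p %| l`! = false.
  elim: l => [|l IHl] lp; first by rewrite dvdn1; apply/negbTE; rewrite neq_ltn prime_gt1 ?orbT.
  by rewrite factS Euclid_dvdM // IHl ?(ltnW lp) // orbF gtnNdvd.
by rewrite !nf ?orbF //; lia.
Qed.

Definition prime_count (n : nat) := size (primes_upto n).

Lemma prime_count_le n : prime_count n <= n.
Proof. by rewrite /prime_count size_filter (leq_trans (count_size _ _)) ?size_iota. Qed.

Lemma leq_prime_count m n : m <= n -> prime_count m <= prime_count n.
Proof.
move=> mn; apply: uniq_leq_size; first exact: primes_upto_uniq.
by move=> p; rewrite !mem_primes_upto => /andP[-> /leq_trans]; apply.
Qed.

Lemma prod_ge_exp (s : seq nat) b :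
  {in s, forall p, b <= p} -> b ^ size s <= \prod_(p <- s) p.
Proof.
elim: s => [|p s IH] H /=; first by rewrite big_nil.
rewrite big_cons expnS leq_mul ?H ?mem_head // IH // => q qs.
by apply: H; rewrite inE qs orbT.
Qed.

(** Split at [2 ^ h], about the square root of n: the primes below are few, and the number z of
    those above satisfies (2 ^ h) ^ z <= 4 ^ n by the primorial bound. *)
Lemma prime_count_upper n : prime_count n * trunc_log 2 n <= 7 * n.
Proof.
have [->|n0] := posnP n; first by rewrite /prime_count.
set L := trunc_log 2 n; pose h := L./2.
have Ln : 2 ^ L <= n by apply: trunc_logP.
have hs : prime_count n <= 2 ^ h + size [seq p <- primes_upto n | 2 ^ h < p].
  rewrite /prime_count -(count_predC (fun p => 2 ^ h < p) (primes_upto n)) addnC size_filter leq_add2r.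
  rewrite -size_filter -[X in _ <= X](size_iota 1); apply: uniq_leq_size.
    by rewrite !filter_uniq ?iota_uniq.
  move=> p; rewrite mem_filter mem_primes_upto /= -leqNgt mem_iota => /andP[ph /andP[pp _]].
  by rewrite prime_gt0.
set s := [seq p <- _ | _] in hs.
have : (2 ^ h) ^ size s <= 4 ^ n.
  apply: leq_trans (primorial_le n); apply: (leq_trans (prod_ge_exp (s := s) _)).
    by move=> p; rewrite mem_filter => /andP[/ltnW].
  rewrite /s big_filter [X in _ <= X](bigID (fun p => 2 ^ h < p)) /= leq_pmulr // big_seq_cond.
  by rewrite prodn_cond_gt0 // => p; rewrite mem_primes_upto => /andP[/andP[/prime_gt0]].
rewrite -expnM (_ : 4 = 2 ^ 2) // -expnM leq_exp2l // => hsn.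
have pn := prime_count_le n.
have Lh : L <= h.*2.+1 by rewrite /h; lia.
have Lh2 : h.*2 <= L by rewrite /h; lia.
have h2 : h.+1 <= 2 ^ h by apply: ltn_expl.
have hh : 2 ^ h * 2 ^ h <= n.
  by rewrite -expnD addnn; apply: leq_trans Ln; rewrite leq_exp2l.
move: (2 ^ h) (size s) (prime_count n) h2 hh hs hsn pn Lh => X z P h2 hh hs hsn pn Lh.
have : P * L <= P * h.*2.+1 by rewrite leq_mul2l Lh orbT.
have : P * h.*2 <= (X + z) * h.*2 by rewrite leq_mul2r hs orbT.
have : X * h.*2 <= X * (2 * X) by rewrite leq_mul2l; apply/orP; right; lia.
nia.
Qed.

Lemma bin_mid_lower m : 2 ^ m <= 'C(m.*2, m).
Proof.
elim: m => [|m IH]; first by rewrite bin0.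
rewrite doubleS binS expnS mul2n -addnn.
have e : 'C(m.*2.+1, m) = 'C(m.*2.+1, m.+1).
  by rewrite -[RHS]bin_sub; [congr ('C(_, _)); lia | lia].
by rewrite e binS; lia.
Qed.

(** In Legendre's formula each power p ^ k contributes at most 1 to the exponent, and nothing once p
    ^ k > 2 m. *)
Lemma prime_pow_bin_mid p m : prime p -> 0 < m -> p ^ logn p 'C(m.*2, m) <= m.*2.
Proof.
move=> pp m0; have p1 := prime_gt1 pp.
have m2 : 0 < m.*2 by lia.
apply: leq_trans (trunc_logP p1 m2); rewrite leq_exp2l //.
have mm : m <= m.*2 by lia.
have := congr1 (logn p) (bin_fact mm).
have -> : m.*2 - m = m by lia.
rewrite !lognM ?muln_gt0 ?fact_gt0 ?bin_gt0 // !logn_fact //.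
set T := trunc_log p m.*2.
have small k : T < k -> m.*2 %/ p ^ k = 0.
  move=> Tk; apply: divn_small; apply: (leq_trans (trunc_log_ltn _ p1)).
  by rewrite leq_exp2l.
have cut n : n <= m.*2 -> \sum_(1 <= k < n.+1) n %/ p ^ k = \sum_(1 <= k < T.+1) n %/ p ^ k.
  move=> nm; have small' k : T < k -> n %/ p ^ k = 0.
    by move=> Tk; apply/eqP; rewrite -leqn0 -(small k Tk) leq_div2r.
  have [h|h] := leqP n T.
    rewrite [RHS](big_cat_nat _ (n := n.+1)) //= [X in _ = _ + X]big_nat_cond [X in _ = _ + X]big1 ?addn0 // => k /andP[/andP[nk _] _].
    by apply: divn_small; apply: (leq_trans nk); apply: ltnW; apply: ltn_expl.
  rewrite (big_cat_nat _ (n := T.+1)) //=; last by lia.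
  by rewrite [X in _ + X = _]big_nat_cond [X in _ + X = _]big1 ?addn0 // => k /andP[/andP[nk _] _]; apply: small'.
rewrite !cut // => e.
have : \sum_(1 <= k < T.+1) m.*2 %/ p ^ k <= \sum_(1 <= k < T.+1) (m %/ p ^ k + (m %/ p ^ k + 1)).
  apply: leq_sum => k _; have pk : 0 < p ^ k by rewrite expn_gt0 prime_gt0.
  have := ltn_ceil m pk; rewrite -addnn => h.
  rewrite -ltnS ltn_divLR //; nia.
by rewrite !big_split /= -e sum_nat_const_nat muln1; lia.
Qed.

(** The central binomial coefficient is at least 2 ^ m, and it is a product of prime powers, one for
    each prime up to 2 m, all at most 2 m. *)
Lemma prime_count_lower n : 2 <= n -> n <= 8 * (prime_count n * trunc_log 2 n).
Proof.
move=> n2; pose m := n./2; have m0 : 0 < m by rewrite /m; lia.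
have le1 : 'C(m.*2, m) <= m.*2 ^ prime_count m.*2.
  have c0 : 0 < 'C(m.*2, m) by rewrite bin_gt0; lia.
  have -> : 'C(m.*2, m) = \prod_(p <- primes_upto m.*2) p ^ logn p 'C(m.*2, m).
    have sub p : p \in primes 'C(m.*2, m) -> p <= m.*2.
      rewrite mem_primes => /and3P[pp _ pd]; have := prime_pow_bin_mid pp m0.
      apply: leq_trans; rewrite -[X in X <= _]expn1 leq_exp2l ?prime_gt1 //.
      by rewrite logn_gt0 mem_primes pp c0 pd.
    rewrite [LHS](prod_prime_decomp c0) prime_decompE big_map /=.
    rewrite [RHS](bigID (fun p => p \in primes 'C(m.*2, m))) /= [X in _ * X]big1 ?muln1; last first.
      by move=> p; rewrite -logn_gt0 -eqn0Ngt => /eqP ->.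
    rewrite -[RHS]big_filter; apply: perm_big; apply: uniq_perm.
    - exact: primes_uniq.
    - by rewrite filter_uniq ?primes_upto_uniq.
    move=> p; rewrite mem_filter mem_primes_upto; case: (boolP (p \in primes _)) => //= h.
    by rewrite sub // andbT; move: h; rewrite mem_primes => /andP[->].
  rewrite /prime_count; have : all prime (primes_upto m.*2) by rewrite filter_all.
  elim: (primes_upto _) => [|p s IH] /=; first by rewrite big_nil.
  by move=> /andP[pp ps]; rewrite big_cons expnS leq_mul ?IH ?prime_pow_bin_mid.
have le2 : m.*2 <= 2 ^ (trunc_log 2 n).+1.
  by apply: ltnW; apply: leq_trans (trunc_log_ltn n _) => //; rewrite ltnS /m; lia.
have : 2 ^ m <= 2 ^ ((trunc_log 2 n).+1 * prime_count n).
  apply: (leq_trans (bin_mid_lower m)); apply: (leq_trans le1).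
  rewrite expnM; apply: (@leq_trans ((2 ^ (trunc_log 2 n).+1) ^ prime_count m.*2)).
    by case: (prime_count _) => // c; rewrite leq_exp2r.
  by rewrite leq_pexp2l ?expn_gt0 // leq_prime_count // /m; lia.
rewrite leq_exp2l // => h.
have : 0 < trunc_log 2 n by rewrite trunc_log_gt0.
by move: (trunc_log 2 n) (prime_count n) h => L P; rewrite /m => h L0; nia.
Qed.

(** * Polynomials with a rational root *)

(** With b the integer part of L / (2 a), both L + 1 <= (b + 1) ^ 2 and b + 1 <= 2 ^ b hold. This
    explicit threshold later absorbs powers of logarithms. *)
Lemma poly_le_exp2 a L : (2 * a) ^ 2 <= L -> L.+1 ^ a <= 2 ^ L.
Proof.
case: (posnP a) => [-> _|a0 aL]; first by rewrite expn0 expn_gt0.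
pose b := L %/ (2 * a).
have b1 : b.+1 <= 2 ^ b by apply: ltn_expl.
have ab : 2 * a <= b by rewrite leq_divRL ?muln_gt0 //; rewrite -mulnn in aL.
have Lb : L < b.+1 * (2 * a) by apply: ltn_ceil; rewrite muln_gt0.
have h : L.+1 <= b.+1 ^ 2 by apply: (leq_trans Lb); rewrite -mulnn leq_mul2l ltnW ?orbT.
apply: (@leq_trans (b.+1 ^ (2 * a))); first by rewrite expnM leq_exp2r.
apply: (@leq_trans ((2 ^ b) ^ (2 * a))); first by rewrite leq_exp2r // muln_gt0.
by rewrite -expnM leq_exp2l // leq_trunc_div.
Qed.

Lemma logn_le_trunc_log p n m : 0 < n -> n <= m -> logn p n <= trunc_log 2 m.
Proof.
move=> n0 nm; have [pp|np] := boolP (prime p); last by rewrite lognE (negPf np).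
apply: trunc_log_max => //; apply: leq_trans nm.
apply: (@leq_trans (p ^ logn p n)); last by apply: dvdn_leq => //; apply: pfactor_dvdnn.
by case: (logn p n) => // l; rewrite leq_exp2r ?prime_gt1.
Qed.

(** A y-smooth number is determined by its exponents at the primes up to y, each at most the binary
    logarithm of n. *)
Lemma smooth_count (y n : nat) (s : seq nat) : uniq s ->
    {in s, forall i, 0 < i <= n /\ forall p, prime p -> p %| i -> p <= y} ->
  size s <= (trunc_log 2 n).+1 ^ y.+1.
Proof.
move=> us hs.
pose L := trunc_log 2 n.
pose phi i : {ffun 'I_y.+1 -> 'I_L.+1} := [ffun p : 'I_y.+1 => inord (logn p i)].
have inj : {in s &, injective phi}.
  move=> i j si sj eij.
  have [/andP[i0 iN] hi] := hs i si; have [/andP[j0 jN] hj] := hs j sj.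
  apply: eqn_from_log => // p.
  have [pp|np] := boolP (prime p); last by rewrite lognE [RHS]lognE (negPf np).
  have [py|yp] := leqP p y.
    move/ffunP/(_ (Ordinal (py : p < y.+1)))/(congr1 val): eij.
    by rewrite !ffunE /= !inordK // ltnS logn_le_trunc_log.
  have nd l : (forall p, prime p -> p %| l -> p <= y) -> logn p l = 0.
    move=> hl; apply/eqP; rewrite -leqn0 leqNgt logn_gt0 mem_primes.
    by apply/negP => /and3P[_ _ /hl]; rewrite leqNgt yp => /(_ pp).
  by rewrite !nd.
rewrite -(size_map phi); apply: (@leq_trans #|{: {ffun 'I_y.+1 -> 'I_L.+1}}|).
  by rewrite cardE; apply: uniq_leq_size; rewrite ?map_inj_in_uniq // => x _; rewrite mem_enum.
by rewrite card_ffun !card_ord.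
Qed.

(** A denominator-free form of the divergence of the sum of 1/p over the primes in [T]: products of
    1 - 1/p over finite sets of them beyond any [P] become arbitrarily small. This is what the
    greedy stage consumes. *)
Definition sieving (T : nat -> Prop) := forall P E : nat, exists S : seq nat,
  [/\ uniq S, all prime S, {in S, forall p, P < p /\ T p} &
      E * \prod_(p <- S) p.-1 <= \prod_(p <- S) p].

Lemma trunc_log_div2exp n e : 2 ^ e <= n -> trunc_log 2 n <= trunc_log 2 (n %/ 2 ^ e) + e.
Proof.
move=> en; have n0 : 0 < n by apply: leq_trans en; rewrite expn_gt0.
have eL : e <= trunc_log 2 n by apply: trunc_log_max.
rewrite addnC -leq_subLR; apply: trunc_log_max => //; rewrite leq_divRL ?expn_gt0 //.
by rewrite -expnD subnK // trunc_logP.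
Qed.

(** From k <= 24 pi(k/2) L and pi(z) L <= 14 z with z <= k / 1024, the primes up to z cost less than
    k / 2, as 24 * 14 < 512; hence 48. The threshold 2 ^ 20 makes the logarithm of z at least half
    that of k. *)
Lemma primes_between_lower k : 2 ^ 20 <= k ->
  k <= 48 * ((prime_count k./2 - prime_count (k %/ 2 ^ 10)) * trunc_log 2 k).
Proof.
move=> k20; set L := trunc_log 2 k; set z := k %/ 2 ^ 10.
have k3 : 4 <= k by apply: leq_trans k20; apply: (@leq_pexp2l 2 2 20).
have L20 : 20 <= L by apply: trunc_log_max.
have h1 : k <= 24 * (prime_count k./2 * L).
  have := @prime_count_lower k./2; have : trunc_log 2 k./2 <= L by apply: leq_trunc_log; lia.
  set P := prime_count _; set l := trunc_log _ _ => lL /(_ _) h.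
  have : P * l <= P * L by rewrite leq_mul2l lL orbT.
  have : 1 < k./2 by lia.
  by move=> /h; lia.
have h2 : prime_count z * L <= 14 * z.
  have : L <= trunc_log 2 z + 10 by apply: trunc_log_div2exp; apply: leq_trans k20; rewrite leq_exp2l.
  have := prime_count_upper z; set P := prime_count _; set l := trunc_log _ _ => a b.
  have : P * L <= P * (2 * l) by rewrite leq_mul2l; apply/orP; right; lia.
  lia.
have zk : z * 1024 <= k by have := leq_trunc_div k (2 ^ 10); rewrite -/z (_ : 2 ^ 10 = 1024).
rewrite mulnBl; lia.
Qed.

Lemma block_of_all_roots (f : {poly int}) (v : nat) :
    sieving (fun=> True) ->
    (forall p, prime p -> v < p -> has_root_mod f p) ->
  exists G, forall k, G <= k -> exists m, block_prop f k m.
Proof.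
move=> sv rts.
(* At most (7 * 2 ^ 10 + 1) k / L positions survive the removal of multiples, against at least k /
   (48 L) primes in (k / 2 ^ 10, k / 2]; the greedy stage has to gain the quotient. *)
pose E := 48 * (7 * 2 ^ 10 + 1).
have [S1 [uS1 pS1 S1v hS1]] := sv v E.
pose y := \max_(p <- S1) p + v.
have S1y p : p \in S1 -> p <= y.
  by move=> pS; apply: leq_trans (leq_addr _ _); rewrite big_seq (leq_bigmax_seq _) // -big_seq.
(* The three bounds serve [primes_between_lower], the inequality y < z, and (L + 1) ^ (y + 2) <= 2 ^
   L through [poly_le_exp2]. *)
pose G := maxn (2 ^ 20) (maxn (2 ^ 11 * y.+1) (2 ^ (2 * y.+2) ^ 2)).
exists G => k; rewrite !geq_max => /and3P[k20 ky kL].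
set L := trunc_log 2 k; set z := k %/ 2 ^ 10.
have kgt0 : 0 < k by apply: leq_trans k20; rewrite expn_gt0.
have yz : y < z by rewrite /z leq_divRL ?expn_gt0 //; apply: leq_trans ky; rewrite expnS; nia.
have zk : 2 * z <= k.
  by have := leq_trunc_div k (2 ^ 10); rewrite -/z (_ : 2 ^ 10 = 1024) //; lia.
pose S0 := [seq p <- primes_upto z | y < p].
pose Q := [seq p <- primes_upto k./2 | z < p].
have szQ : size Q = prime_count k./2 - prime_count z.
  rewrite /prime_count -(count_predC (fun p => z < p) (primes_upto k./2)) -size_filter -/Q.
  rewrite -[X in _ + X]size_filter.
  suff -> : size [seq p <- primes_upto k./2 | predC (fun p => z < p) p] = size (primes_upto z).
    by rewrite addnK.
  apply: perm_size; apply: uniq_perm; rewrite ?filter_uniq ?iota_uniq // => p.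
  rewrite mem_filter !mem_primes_upto /= -leqNgt; case: (prime p) => /=; rewrite ?andbF //.
  by apply/andP/idP => [[]//|h]; split=> //; lia.
have pS0 p : p \in S0 -> [/\ prime p, y < p & p <= z].
  by rewrite mem_filter mem_primes_upto => /and3P[].
have pQ p : p \in Q -> [/\ prime p, z < p & 2 * p <= k].
  by rewrite mem_filter mem_primes_upto => /and3P[-> -> h]; split=> //; lia.
have vy : v <= y by rewrite leq_addl.
apply: (@block_of_classes f k S0 S1 Q).
- rewrite !cat_uniq uS1 !filter_uniq ?iota_uniq //= andbT has_cat negb_or.
  rewrite -andbA; apply/and3P; split; apply/hasPn => p.
  + by move=> /S1y py; apply/negP => /pS0[_]; lia.
  + by move=> /pQ[_ zp _]; apply/negP => /pS0[_]; lia.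
  by move=> /pQ[_ zp _]; apply/negP => /S1y; lia.
- rewrite !all_cat pS1 /=; apply/andP; split; apply/allP => p.
    by case/pS0.
  by case/pQ.
- move=> p; rewrite mem_cat => /orP[/pS0[pp yp pz]|pS].
    by split; [apply: rts => //; lia | lia].
  split; first by apply: rts; [apply: (allP pS1) | have [] := S1v p pS].
  by have := S1y p pS; lia.
(* A single root suffices: r and r + p form the pair, at distance p <= k / 2. *)
- move=> p /pQ[pp zp pk]; have [|r hr] := rts p pp; first lia.
  exists r, p; split=> //; first exact: prime_gt0.
  by rewrite (dvdz_horner_modn f (b := r)) // modnDr.
set U := [seq i <- _ | _].
have P0 : 0 < \prod_(p <- S1) p.
  by rewrite big_seq_cond prodn_cond_gt0 // => p /andP[/(allP pS1)/prime_gt0].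
suff hU : size U <= E * size Q.
  apply: (@leq_trans (E * size Q * \prod_(p <- S1) p.-1)); first by rewrite leq_mul2r hU orbT.
  by rewrite mulnAC mulnC leq_mul2l hS1 orbT.
have L0 : 0 < L by apply: (@leq_trans 20) => //; apply: trunc_log_max.
have hUp i : i \in U -> [/\ 0 < i, i <= k & forall p, prime p -> p %| i -> p <= y \/ z < p].
  rewrite mem_filter mem_iota add1n ltnS => /andP[/allP h /andP[i0 ik]]; split=> // p pp pi.
  case: (leqP p y) => [|yp]; first by left.
  case: (leqP p z) => [pz|]; last by right.
  have /h : p \in S0 by rewrite mem_filter yp mem_primes_upto pp.
  by rewrite pi.
(* A survivor has no prime factor in (y, z]. If it is not y-smooth, it is p * s with p > z, hence s
   < 2 ^ 10. *)
pose smooth i := all (fun p => p <= y) (primes i).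
have sU : size U <= size [seq i <- U | smooth i] + size [seq i <- U | ~~ smooth i].
  by rewrite -(count_predC smooth U) -!size_filter.
have h1 : size [seq i <- U | smooth i] * L <= k.
  have : size [seq i <- U | smooth i] <= L.+1 ^ y.+1.
    apply: smooth_count; first by rewrite !filter_uniq ?iota_uniq.
    move=> i; rewrite mem_filter => /andP[/allP sm /hUp[i0 ik _]]; rewrite i0 ik; split=> // p pp pi.
    by apply: sm; rewrite mem_primes pp i0.
  move=> h; apply: (@leq_trans (L.+1 ^ y.+1 * L.+1)); first by rewrite leq_mul.
  rewrite -expnSr; apply: (leq_trans (poly_le_exp2 _)) (trunc_logP _ kgt0) => //.
  by apply: trunc_log_max.
have h2 : size [seq i <- U | ~~ smooth i] <= 2 ^ 10 * prime_count k.
  pose W := [seq p * s | p <- primes_upto k, s <- iota 0 (2 ^ 10)].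
  have -> : 2 ^ 10 * prime_count k = size W.
    by rewrite size_allpairs size_iota mulnC.
  apply: uniq_leq_size; first by rewrite !filter_uniq ?iota_uniq.
  move=> i; rewrite mem_filter => /andP[/allPn[p]]; rewrite mem_primes => /and3P[pp i0 pi] py.
  case/hUp => _ ik /(_ p pp pi)[h|zp]; first by rewrite h in py.
  have pdi : p * (i %/ p) = i by rewrite mulnC divnK.
  rewrite -pdi /W; apply: (@allpairs_f _ _ _ muln).
    by rewrite mem_primes_upto pp; apply: leq_trans ik; apply: dvdn_leq.
  rewrite mem_iota add0n /= ltn_divLR ?prime_gt0 //.
  have := ltn_ceil k (_ : 0 < 2 ^ 10); rewrite -/z expn_gt0 => /(_ isT) h.
  by apply: (leq_ltn_trans ik); apply: (leq_trans h); rewrite mulnC leq_mul2l zp orbT.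
have h3 := prime_count_upper k; rewrite -/L in h3.
have h4 := primes_between_lower k20; rewrite -/L -/z -szQ in h4.
rewrite -(leq_pmul2r L0).
apply: (@leq_trans ((7 * 2 ^ 10 + 1) * k)).
  move: (size [seq i <- U | smooth i]) (size [seq i <- U | ~~ smooth i]) (prime_count k) h1 h2 h3 sU.
  move: (2 ^ 10) (size U) => D u a b c h1 h2 h3 sU; clear -h1 h2 h3 sU; move: L h1 h3 => l h1 h3.
  have : u * l <= (a + b) * l by rewrite leq_mul2r sU orbT.
  have : b * l <= D * c * l by rewrite leq_mul2r h2 orbT.
  have : D * (c * l) <= D * (7 * k) by rewrite leq_mul2l h3 orbT.
  lia.
by rewrite /E [48 * _]mulnC -!mulnA leq_mul2l h4 orbT.
Qed.

(** * Divergence of the sum of inverses of the primes having a root *)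

Local Open Scope ring_scope.

(* The companion matrix of a monic [g] of size [n.+2], with a dimension that is
   not computed from [g]. *)
Definition mulX_mx (R : comNzRingType) (n : nat) (g : {poly R}) : 'M[R]_n.+1 :=
  \matrix_(i, j) if i == n :> nat then - g`_j else (i.+1 == j :> nat)%:R.

Lemma rVpoly_mulX_mx (R : comNzRingType) n (g : {poly R}) (u : 'rV[R]_n.+1) :
    g \is monic -> size g = n.+2 ->
  rVpoly u * 'X = rVpoly (u *m mulX_mx n g) + u 0 ord_max *: g.
Proof.
move=> gm sg; apply/polyP => j; rewrite coefD coefZ coefMX.
have gn : g`_n.+1 = 1 by move/monicP: gm; rewrite lead_coefE sg.
have [jn|nj] := ltnP j n.+1; last first.
  rewrite [(rVpoly (u *m _))`_j]nth_default ?add0r; last first.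
    by apply: leq_trans nj; apply: size_poly.
  have -> : (j == 0)%N = false by case: j nj.
  have [->|jn] := eqVneq j n.+1.
    by rewrite gn mulr1 /= (coef_rVpoly_ord u ord_max).
  rewrite !nth_default ?mulr0 //; first by rewrite sg; lia.
  by apply: leq_trans (size_poly _ _) _; lia.
rewrite [in RHS](coef_rVpoly_ord (u *m _) (Ordinal jn)) mxE.
rewrite big_ord_recr /= mxE /= eqxx mulrN subrK.
case: j jn => [|j] jn /=.
  by rewrite big1 // => i _; rewrite !mxE /= ltn_eqF ?mulr0 // ltn_ord.
have jn' : (j < n)%N by [].
rewrite (bigD1 (Ordinal jn')) //= mxE /= eqSS eqxx ltn_eqF // mulr1 big1 ?addr0.
  by rewrite (coef_rVpoly_ord u (widen_ord (leqnSn n) (Ordinal jn'))).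
move=> i; rewrite -val_eqE /= mxE /= eqSS => /negPf ->.
by rewrite ltn_eqF ?mulr0 // ltn_ord.
Qed.

(** On row vectors [mulX_mx] acts as multiplication by X in K[X]/(g), so a polynomial in it acts as
    multiplication by that polynomial. *)
Lemma rVpoly_horner_mulX_mx (K : fieldType) n (g v : {poly K}) (u : 'rV[K]_n.+1) :
    g \is monic -> size g = n.+2 ->
  rVpoly (u *m horner_mx (mulX_mx n g) v) = (rVpoly u * v) %% g.
Proof.
move=> gm sg; have small (w : 'rV[K]_n.+1) : (size (rVpoly w) < size g)%N.
  by rewrite sg ltnS size_poly.
elim/poly_ind: v => [|v c IH]; first by rewrite rmorph0 mulmx0 mulr0 mod0p raddf0.
rewrite rmorphD rmorphM /= horner_mx_X horner_mx_C mulmxDr mul_mx_scalar.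
rewrite [LHS]linearD [X in _ + X = _]linearZ /= mulmxA.
have -> : rVpoly (u *m horner_mx (mulX_mx n g) v *m mulX_mx n g) =
    (rVpoly (u *m horner_mx (mulX_mx n g) v) * 'X) %% g.
  by rewrite (rVpoly_mulX_mx _ gm sg) modpD modpZl modpp scaler0 addr0 modp_small.
rewrite IH mulrC modp_mul mulrCA mulrDr modpD [v * _]mulrC; congr (_ + _).
by rewrite mulrC mul_polyC modpZl modp_small.
Qed.

(** The determinant is the norm of v in K[X]/(g). Multiplication by v is injective when v is prime
    to g, and otherwise g / gcd(v, g) is a nonzero kernel vector. *)
Lemma det_horner_mulX_mx (K : fieldType) n (g v : {poly K}) :
    g \is monic -> size g = n.+2 ->
  (\det (horner_mx (mulX_mx n g) v) == 0) = ~~ coprimep v g.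
Proof.
move=> gm sg; have g0 : g != 0 by apply: monic_neq0.
apply/det0P/idP => [[u u0 uv]|ncop].
  apply/negP => cop; have := rVpoly_horner_mulX_mx v u gm sg.
  rewrite uv raddf0 => /esym/modp_eq0P; rewrite Gauss_dvdpl 1?coprimep_sym //.
  have ru : rVpoly u != 0 by apply: contraNneq u0 => ru; rewrite -[u]rVpolyK ru raddf0.
  by move/(dvdp_leq ru); rewrite sg leqNgt ltnS size_poly.
pose h := gcdp v g; pose g1 : {poly K} := g %/ h.
have gE : g = g1 * h by rewrite divpK // dvdp_gcdr.
have vE : v = v %/ h * h by rewrite divpK // dvdp_gcdl.
have g10 : g1 != 0 by apply: contra_neq g0; rewrite gE => ->; rewrite mul0r.
have h0 : h != 0 by rewrite gcdp_eq0 (negPf g0) andbF.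
have sh : (1 < size h)%N.
  by move: ncop; rewrite /coprimep -/h; move: h0; rewrite -size_poly_gt0; lia.
have sg1 : (size g1 <= n.+1)%N.
  have := size_mul g10 h0; rewrite -gE sg; move: sh; move: (size h) (size g1); lia.
have ru : rVpoly (poly_rV g1 : 'rV[K]_n.+1) = g1 by apply: poly_rV_K.
exists (poly_rV g1).
  by apply: contraNneq g10 => e; rewrite -ru e raddf0.
apply: (can_inj rVpolyK); rewrite raddf0 (rVpoly_horner_mulX_mx _ _ gm sg) ru.
by rewrite {1}vE mulrCA -gE modp_mull.
Qed.

(** For [g] monic of degree n + 1, the norm of the element of Z[X]/(g) with coordinates [u]. The
    matrix form commutes with reduction modulo p and with the embedding into the rationals. *)
Definition rV_norm n (g : {poly int}) (u : 'rV[int]_n.+1) : int :=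
  \det (horner_mx (mulX_mx n g) (rVpoly u)).

Lemma map_rV_norm (K : comNzRingType) n (g : {poly int}) (u : 'rV[int]_n.+1) :
  (rV_norm g u)%:~R =
    \det (horner_mx (mulX_mx n (map_poly intr g)) (map_poly intr (rVpoly u))) :> K.
Proof.
rewrite /rV_norm -det_map_mx map_horner_mx; congr (\det (horner_mx _ _)).
apply/matrixP => i j; rewrite !mxE coef_map.
by case: ifP => _; rewrite ?rmorphN //= rmorph_nat.
Qed.

(** Degree at most 3 enters here: absence of roots implies irreducibility. *)
Lemma coprimep_of_no_root (K : fieldType) (g v : {poly K}) :
    (1 < size g <= 4)%N -> (forall x, ~~ root g x) -> v != 0 -> (size v < size g)%N ->
  coprimep v g.
Proof.
move=> sg nr v0 svg; have [_ irr] := cubic_irreducible sg nr.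
apply: contraT; rewrite /coprimep => /irr/(_ (dvdp_gcdr _ _)) e.
have : g %| v by rewrite -(eqp_dvdl _ e) dvdp_gcdl.
by move/(dvdp_leq v0); rewrite leqNgt svg.
Qed.

(** In the second case the gcds with g have no root, so they have degree at least 2 and divide the
    cofactor [q] of X - r0, of degree at most 2. Both are associated to [q], which therefore divides
    v - w. This replaces an argument with the prime ideals above p. *)
Lemma not_coprimep_subr (K : fieldType) (g v w : {poly K}) (r0 : K) :
    (size g <= 4)%N -> g != 0 -> root g r0 ->
    ~~ coprimep v g -> ~~ coprimep w g ->
    (exists2 r, root g r & root v r && root w r) \/
    (forall r, root g r -> ~~ root v r && ~~ root w r) ->
  ~~ coprimep (v - w) g.
Proof.
move=> sg g0 gr0 ncv ncw [[r gr /andP[vr wr]]|nr].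
  apply/negP => /coprimep_root cop.
  have : root (v - w) r by rewrite rootE hornerD hornerN (eqP vr) (eqP wr) subrr.
  by move/(fun h => cop r h); rewrite rootE in gr; rewrite (eqP gr) eqxx.
pose q : {poly K} := g %/ ('X - r0%:P).
have gE : g = q * ('X - r0%:P) by rewrite divpK // dvdp_XsubCl.
have q0 : q != 0 by apply: contra_neq g0; rewrite gE => ->; rewrite mul0r.
have sq : size g = (size q).+1 by rewrite gE size_Mmonic ?monicXsubC // size_XsubC addn2.
have key x : ~~ coprimep x g -> (forall r, root g r -> ~~ root x r) -> (q %| x) && (1 < size q)%N.
  move=> nc nrx; pose h := gcdp x g.
  have hx : h %| x := dvdp_gcdl _ _; have hg : h %| g := dvdp_gcdr _ _.
  have hr r : ~~ root h r.
    apply/negP => rh; have /nrx/negP[] : root g r by apply: (root_dvdp hg).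
    by apply: (root_dvdp hx).
  have h0 : h != 0 by apply: contraNneq (hr 0) => ->; rewrite root0.
  have s1 : size h != 1%N by [].
  have s2 : size h != 2%N by apply/eqP => /poly2_root[r rh]; have := hr r; rewrite rh.
  have hq : h %| q.
    rewrite -(@Gauss_dvdpl _ q ('X - r0%:P) h) -?gE //.
    by rewrite coprimep_XsubC.
  have sh : (2 < size h)%N by move: h0 s1 s2; rewrite -size_poly_gt0; case: (size h) => [|[|[|]]].
  have shq := dvdp_leq q0 hq.
  have e : h %= q by rewrite -dvdp_size_eqp // eqn_leq shq; rewrite sq ltnS in sg; exact: leq_trans sg sh.
  by rewrite -(eqp_dvdl _ e) hx (leq_trans _ shq) // ltnW.
have /andP[qv sq1] := key v ncv (fun r gr => proj1 (andP (nr r gr))).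
have /andP[qw _] := key w ncw (fun r gr => proj2 (andP (nr r gr))).
apply/negP => cop.
have := dvdp_leq (monic_neq0 (monic1 K)) ((_ : q %| 1)).
rewrite size_poly1 leqNgt sq1 => /(_ _)/negP; apply=> //.
rewrite -(eqp_dvdr _ (_ : gcdp (v - w) g %= 1)) ?dvdp_gcd -?size_poly_eq1 //.
by rewrite dvdp_sub //= gE dvdp_mulr.
Qed.

Lemma dvdz_rV_norm p n (g : {poly int}) (u : 'rV[int]_n.+1) :
    prime p -> g \is monic -> size g = n.+2 ->
  (p%:Z %| rV_norm g u)%Z =
    ~~ coprimep (map_poly intr (rVpoly u) : {poly 'F_p}) (map_poly intr g).
Proof.
move=> pp gm sg; rewrite (dvdz_pcharf (pchar_Fp pp)) map_rV_norm.
by rewrite det_horner_mulX_mx ?monic_map ?size_map_poly_id0 // ?sg // (monicP gm) rmorph1 oner_neq0.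
Qed.

Definition no_rat_root (g : {poly int}) := forall x : rat, ~~ root (map_poly intr g) x.

(** Over the rationals g is irreducible, so multiplication by a nonzero element is injective. *)
Lemma rV_norm_eq0 n (g : {poly int}) (u : 'rV[int]_n.+1) :
    g \is monic -> size g = n.+2 -> (n <= 2)%N -> no_rat_root g ->
  rV_norm g u = 0 -> u = 0.
Proof.
move=> gm sg n2 nr; move/(congr1 (intr : int -> rat)); rewrite map_rV_norm.
have gm' : map_poly intr g \is @monic rat by apply: monic_map.
have sg' : size (map_poly (intr : int -> rat) g) = n.+2.
  by rewrite size_map_poly_id0 // (monicP gm) rmorph1 oner_neq0.
move/eqP; rewrite mulr0z det_horner_mulX_mx // => ncop; apply/eqP; apply: contraNT ncop => u0.
apply: coprimep_of_no_root => //; rewrite ?sg' //.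
  apply: contra_neq u0 => h; apply/rowP => i; rewrite mxE; apply/eqP.
  move/polyP/(_ i): h; rewrite coef_map coef0 coef_rVpoly_ord => /eqP.
  by rewrite intr_eq0.
by apply: leq_ltn_trans (size_poly _ _) _; rewrite ltnS; apply: leq_trans (size_poly _ _) _.
Qed.

Lemma horner_mx_rVpoly_sum (R : comNzRingType) n (A : 'M[R]_n.+1) (u : 'rV[R]_n.+1) :
  horner_mx A (rVpoly u) = \sum_(i < n.+1) u 0 i *: A ^+ i.
Proof.
have -> : rVpoly u = \sum_(i < n.+1) (u 0 i)%:P * 'X^i.
  by rewrite /rVpoly poly_def; apply: eq_bigr => i _; rewrite valK mul_polyC.
rewrite rmorph_sum; apply: eq_bigr => i _.
by rewrite [LHS]rmorphM rmorphXn /= horner_mx_X horner_mx_C -mul_scalar_mx.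
Qed.

Lemma rV_norm_bound n (g : {poly int}) : exists2 C : nat, (0 < C)%N &
  forall (u : 'rV[int]_n.+1) (B : nat), (forall i, `|u 0 i| <= B%:Z) ->
    (`|rV_norm g u| <= C * B ^ n.+1)%N.
Proof.
pose M := mulX_mx n g.
pose A : int := \sum_(i < n.+1) \sum_j \sum_k `|(M ^+ i) j k|.
have A0 : 0 <= A by do 3! (apply: sumr_ge0 => ? _).
have entry (u : 'rV[int]_n.+1) (B : nat) j k : (forall i, `|u 0 i| <= B%:Z) ->
    `|horner_mx M (rVpoly u) j k| <= A * B%:Z.
  move=> hu; rewrite horner_mx_rVpoly_sum summxE (le_trans (ler_norm_sum _ _ _)) //.
  rewrite /A mulr_suml; apply: ler_sum => i _; rewrite mxE normrM mulrC.
  apply: ler_pM => //; rewrite (bigD1 j) //= (bigD1 k) //=.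
  rewrite -addrA lerDl addr_ge0 //; first by apply: sumr_ge0.
  by apply: sumr_ge0 => ? _; apply: sumr_ge0.
exists (n.+1`! * `|A|.+1 ^ n.+1)%N; first by rewrite muln_gt0 fact_gt0 expn_gt0.
move=> u B hu; rewrite -lez_nat abszE /rV_norm /determinant.
apply: (le_trans (ler_norm_sum _ _ _)).
apply: (@le_trans _ _ (\sum_(s : 'S_n.+1) (`|A|.+1 * B)%:Z ^+ n.+1)).
  apply: ler_sum => s _; rewrite normrM normrX normrN1 expr1n mul1r normr_prod.
  have -> : (`|A|.+1 * B)%:Z ^+ n.+1 = \prod_(i < n.+1) (`|A|.+1 * B)%:Z.
    by rewrite prodr_const card_ord.
  apply: ler_prod => i _; rewrite normr_ge0 /=.
  apply: (le_trans (entry u B i (s i) hu)); rewrite PoszM ler_wpM2r //.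
  by move: A0; clear; case: A => //= a _; lia.
rewrite sumr_const card_Sn -mulr_natl natz -rmorphXn -PoszM lez_nat.
by rewrite -mulnA -expnMn; apply: leqnn.
Qed.

Lemma horner_char_poly (R : comNzRingType) n (A : 'M[R]_n) (x : R) :
  (char_poly A).[x] = \det (x%:M - A).
Proof.
rewrite -[LHS]/(horner_eval x _) /char_poly -det_map_mx; congr (\det _).
apply/matrixP => i j; rewrite !mxE /= /horner_eval hornerD hornerN hornerC.
by rewrite hornerMn hornerX.
Qed.

Lemma card_le_fibers (T U : finType) (phi : T -> U) (A : {set T}) c :
  (forall y, #|[set a in A | phi a == y]| <= c)%N -> (#|A| <= c * #|U|)%N.
Proof.
move=> h; rewrite -sum1_card (partition_big phi predT) //=.
apply: (@leq_trans (\sum_(y : U) c)%N); last by rewrite sum_nat_const mulnC.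
apply: leq_sum => y _; apply: leq_trans (h y); rewrite sum1dep_card.
by apply/eq_leq/eq_card => a; rewrite !inE.
Qed.

(** * Box vectors whose norm is divisible by a given prime *)

Definition box_vec n B (a : {ffun 'I_n.+1 -> 'I_B}) : 'rV[int]_n.+1 := \row_i (a i : nat)%:Z.

Lemma box_vec_inj n B : injective (@box_vec n B).
Proof.
move=> a b e; apply/ffunP => i; apply/val_inj.
by move/rowP/(_ i): e; rewrite !mxE => -[].
Qed.

(** With all coordinates but the first fixed, the norm is a monic polynomial of degree n + 1 in the
    first one, namely the characteristic polynomial of [- W]. *)
Lemma box_norm_fiber n B (g : {poly int}) (m : int) :
  (#|[set a : {ffun 'I_n.+1 -> 'I_B} | rV_norm g (box_vec a) == m]| <= n.+1 * B ^ n)%N.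
Proof.
pose phi (a : {ffun 'I_n.+1 -> 'I_B}) : {ffun 'I_n -> 'I_B} := [ffun i => a (lift ord0 i)].
have -> : (B ^ n = #|{: {ffun 'I_n -> 'I_B}}|)%N by rewrite card_ffun !card_ord.
apply: (card_le_fibers (phi := phi)) => b; set F := [set _ in _ | _].
pose W := \sum_(i < n) (b i : nat)%:Z *: (mulX_mx n g) ^+ i.+1.
pose P := char_poly (- W) - m%:P.
have sP : size P = n.+2.
  by rewrite /P size_polyDl size_char_poly // size_polyN; apply: leq_ltn_trans (size_polyC_leq1 _) _.
have P0 : P != 0 by rewrite -size_poly_gt0 sP.
have vE a : a \in F -> P.[(a ord0 : nat)%:Z] = 0.
  rewrite !inE => /andP[/eqP hm /eqP ab].
  rewrite /P -hm hornerD hornerN hornerC horner_char_poly opprK; apply/eqP; rewrite subr_eq0.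
  apply/eqP; congr (\det _); rewrite horner_mx_rVpoly_sum big_ord_recl !mxE expr0.
  rewrite scalemx1; congr (_ + _); apply: eq_bigr => i _.
  by rewrite mxE -ab ffunE.
pose s := [seq (a ord0 : nat)%:Z | a : {ffun 'I_n.+1 -> 'I_B} <- enum F].
have -> : #|F| = size s by rewrite size_map -cardE.
rewrite -ltnS -sP; apply: max_poly_roots => //.
  by apply/allP => x /mapP[a]; rewrite mem_enum => /vE aF ->; apply/eqP.
rewrite map_inj_in_uniq ?enum_uniq // => a a'; rewrite !mem_enum !inE.
move=> /andP[_ /eqP h] /andP[_ /eqP h'] [e]; apply/ffunP => i.
case: (unliftP ord0 i) => [j ->|->]; last by apply: val_inj.
by move/ffunP/(_ j): h; move/ffunP/(_ j): h'; rewrite !ffunE => -> ->.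
Qed.

Definition rooted (g : {poly int}) (p : nat) : bool :=
  [exists r : 'F_p, root (map_poly intr g : {poly 'F_p}) r].

Lemma map_rVpoly_sub (K : comNzRingType) n (u w : 'rV[int]_n) :
  map_poly intr (rVpoly (u - w)) = map_poly intr (rVpoly u) - map_poly intr (rVpoly w) :> {poly K}.
Proof. by rewrite raddfB rmorphB. Qed.

Lemma distz_of_eq_divn (s x y : nat) :
  (0 < s)%N -> (x %/ s = y %/ s)%N -> `|x%:Z - y%:Z| <= s%:Z.
Proof.
move=> s0 e; have := divn_eq x s; have := divn_eq y s; rewrite e.
have := ltn_pmod x s0; have := ltn_pmod y s0; lia.
Qed.

(** The count must have order B ^ (n + 1) / p without boundary term even for p far beyond B, since
    primes up to the size of the norms are summed over. Hence a packing by small cubes rather than a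
    count of residues modulo p. *)
Lemma box_rooted_count n (g : {poly int}) (C0 : nat) :
    g \is monic -> size g = n.+2 -> (n <= 2)%N -> no_rat_root g -> (0 < C0)%N ->
    (forall (u : 'rV[int]_n.+1) (B : nat), (forall i, `|u 0 i| <= B%:Z) ->
       (`|rV_norm g u| <= C0 * B ^ n.+1)%N) ->
  exists C1 : nat, forall B p, prime p -> rooted g p -> (p <= C0 * B ^ n.+1)%N ->
    (#|[set a : {ffun 'I_n.+1 -> 'I_B} | (p%:Z %| rV_norm g (box_vec a))%Z]| * p
       <= C1 * B ^ n.+1)%N.
Proof.
move=> gm sg n2 nr C00 HC0.
(* The first factor compares p with s ^ (n + 1) through p <= C0 (s + 1) ^ (n + 1); the second counts
   four keys in each of (B / s + 1) ^ (n + 1) cubes, with (B / s + 1) s <= 2 B. *)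
exists (C0 * 2 ^ n.+1 * (4 * 2 ^ n.+1))%N => B p pp /existsP[r0 gr0] pB.
set Bad := [set _ | _].
have [pC|Cp] := leqP p C0.
  rewrite mulnC; apply: leq_mul; last by rewrite (leq_trans (max_card _)) // card_ffun !card_ord.
  by apply: (leq_trans pC); rewrite -mulnA leq_pmulr // !muln_gt0 !expn_gt0.
have ex1 : exists s, (C0 * s ^ n.+1 < p)%N by exists 1%N; rewrite exp1n muln1.
have bd s : (C0 * s ^ n.+1 < p)%N -> (s <= p)%N.
  move=> h; apply: ltnW; apply: leq_ltn_trans h; rewrite expnS.
  by case: s => // s; rewrite mulnCA leq_pmulr // muln_gt0 C00 expn_gt0.
have [s sp smax] := ex_maxnP ex1 bd.
have s0 : (0 < s)%N by apply: smax; rewrite exp1n muln1.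
have ps : (p <= C0 * s.+1 ^ n.+1)%N by rewrite leqNgt; apply/negP => /smax; rewrite ltnn.
have sB : (s < B)%N.
  by have := leq_trans sp pB; rewrite ltn_pmul2l // ltn_exp2r.
(* Cut the box into cubes of side [s]: if two vectors of a cube share the same
   root of [g] modulo [p], or share none, the norm of their difference is a
   multiple of [p] smaller than [p], hence zero. *)
pose gp : {poly 'F_p} := map_poly intr g.
have gp0 : gp != 0 by apply: monic_neq0; apply: monic_map.
have sgp : size gp = n.+2 by rewrite size_map_poly_id0 // (monicP gm) rmorph1 oner_neq0.
pose rs := enum [pred r : 'F_p | root gp r].
have srs : (size rs <= 3)%N.
  apply: (@leq_trans n.+1) => //; rewrite -ltnS -sgp; apply: max_poly_roots => //.
    by apply/allP => x; rewrite mem_enum.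
  exact: enum_uniq.
pose vp (a : {ffun 'I_n.+1 -> 'I_B}) : {poly 'F_p} := map_poly intr (rVpoly (box_vec a)).
(* The index of the first root of g shared by [vp a], or [size rs] if there is none; hence at most
   four values. *)
pose key a := find (root (vp a)) rs.
have key3 a : (key a <= 3)%N by apply: leq_trans (find_size _ _) srs.
pose phi (a : {ffun 'I_n.+1 -> 'I_B}) : {ffun 'I_n.+1 -> 'I_(B %/ s).+1} * 'I_4 :=
  ([ffun i => inord (a i %/ s)%N], inord (key a)).
have inj : {in Bad &, injective phi}.
  move=> a b; rewrite !inE => Na Nb [/ffunP e1 /(congr1 val) /=].
  rewrite !inordK ?ltnS // => e2.
  have close i : `|(box_vec a - box_vec b) 0 i| <= s%:Z.
    rewrite !mxE; have /(congr1 val) := e1 i; rewrite !ffunE /=.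
    rewrite !inordK ?ltnS ?leq_div2r ?(ltnW (ltn_ord _)) //; exact: distz_of_eq_divn.
  have Nab : (p%:Z %| rV_norm g (box_vec a - box_vec b))%Z.
    move: Na Nb; rewrite !dvdz_rV_norm // map_rVpoly_sub -!/(vp _) => Na Nb.
    apply: (@not_coprimep_subr _ _ _ _ r0) => //; first by rewrite sgp.
    have [h|h] := boolP (has (root (vp a)) rs).
      left; exists (nth 0 rs (key a)).
        have : nth 0 rs (key a) \in rs by rewrite mem_nth // -has_find.
        by rewrite mem_enum inE.
      rewrite nth_find //= e2 nth_find // has_find.
      by move: h; rewrite has_find -/(key a) e2.
    right=> r gr; have rr : r \in rs by rewrite mem_enum.
    have h' : ~~ has (root (vp b)) rs by rewrite has_find -/(key b) -e2 /key -has_find.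
    by rewrite (hasPn h _ rr) (hasPn h' _ rr).
  have N0 : rV_norm g (box_vec a - box_vec b) = 0.
    apply/eqP; rewrite -absz_eq0; apply: contraTT Nab => nz; rewrite dvdzE /= gtnNdvd //.
      by rewrite lt0n.
    exact: leq_ltn_trans (HC0 _ _ close) sp.
  have /eqP := rV_norm_eq0 gm sg n2 nr N0; rewrite subr_eq0 => /eqP; exact: box_vec_inj.
have cB : (#|Bad| <= (B %/ s).+1 ^ n.+1 * 4)%N.
  rewrite -(card_in_imset inj) (leq_trans (max_card _)) //.
  by rewrite card_prod card_ffun !card_ord.
have h1 : (#|Bad| * s ^ n.+1 <= 4 * 2 ^ n.+1 * B ^ n.+1)%N.
  apply: (@leq_trans (4 * ((B %/ s).+1 * s) ^ n.+1)).
    by rewrite expnMn mulnA leq_mul // mulnC.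
  rewrite -mulnA -expnMn leq_mul // leq_exp2r // mulSn mul2n -addnn leq_add //.
    exact: ltnW.
  exact: leq_trunc_div.
apply: (@leq_trans (#|Bad| * (C0 * (2 ^ n.+1 * s ^ n.+1)))).
  rewrite leq_mul2l (leq_trans ps) ?orbT // leq_mul2l -expnMn leq_exp2r //.
  by rewrite mul2n -addnn -addn1 leq_add ?orbT.
rewrite -[X in (_ <= X)%N]mulnA mulnCA mulnA mulnCA -mulnA [X in (X <= _)%N]mulnCA.
by rewrite -[X in (_ <= X)%N]mulnA !leq_mul2l h1 !orbT.
Qed.

(** Modulo p, g is irreducible, so p divides the norm only if it divides every coordinate. A nonzero
    such vector forces p <= B, so there are at most (2 B / p) ^ (n + 1) of them; n >= 1 allows the
    exponent 2 on p. *)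
Lemma box_inert_count n (g : {poly int}) B p :
    g \is monic -> size g = n.+2 -> (0 < n <= 2)%N -> prime p -> ~~ rooted g p ->
  (#|[set a : {ffun 'I_n.+1 -> 'I_B} | (box_vec a != 0)%R &&
       (p%:Z %| rV_norm g (box_vec a))%Z]| * p ^ 2 <= 2 ^ n.+1 * B ^ n.+1)%N.
Proof.
move=> gm sg /andP[n0 n2] pp; rewrite /rooted negb_exists => /forallP nr.
set Bad := [set _ | _].
have sgp : size (map_poly intr g : {poly 'F_p}) = n.+2.
  by rewrite size_map_poly_id0 // (monicP gm) rmorph1 oner_neq0.
have hBad a : a \in Bad -> forall i, (p %| a i)%N.
  rewrite inE => /andP[_]; rewrite dvdz_rV_norm // => ncop i.
  have v0 : map_poly intr (rVpoly (box_vec a)) = 0 :> {poly 'F_p}.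
    apply/eqP; apply: contraNT ncop => v0; apply: coprimep_of_no_root => //.
      by rewrite sgp; lia.
    by rewrite sgp ltnS; apply: leq_trans (size_poly _ _) _; apply: size_poly.
  move/polyP/(_ i): v0; rewrite coef0 coef_map coef_rVpoly_ord mxE => /eqP.
  by rewrite -(dvdz_pcharf (pchar_Fp pp)).
have [->|[a0 aB]] := set_0Vmem Bad; first by rewrite cards0.
have pB : (p <= B)%N.
  have := aB; rewrite inE => /andP[az _].
  have [i ai] : exists i, a0 i != 0%N :> nat.
    apply/existsP; apply: contraR az; rewrite negb_exists => /forallP h.
    by apply/eqP/rowP => i; rewrite !mxE; have /negPn/eqP-> := h i.
  apply: leq_trans (ltnW (ltn_ord (a0 i))); apply: dvdn_leq; rewrite ?lt0n //.
  exact: hBad.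
pose phi (a : {ffun 'I_n.+1 -> 'I_B}) : {ffun 'I_n.+1 -> 'I_(B %/ p).+1} :=
  [ffun i => inord (a i %/ p)%N].
have inj : {in Bad &, injective phi}.
  move=> a b aBad bBad /ffunP e; apply/ffunP => i; apply: val_inj => /=.
  have /(congr1 val) := e i; rewrite !ffunE /=.
  rewrite !inordK ?ltnS ?leq_div2r ?(ltnW (ltn_ord _)) // => e'.
  by rewrite -(divnK (hBad a aBad i)) e' divnK // hBad.
have cB : (#|Bad| <= (B %/ p).+1 ^ n.+1)%N.
  by rewrite -(card_in_imset inj) (leq_trans (max_card _)) // card_ffun !card_ord.
apply: (@leq_trans (((B %/ p).+1 * p) ^ n.+1)).
  by rewrite expnMn leq_mul // leq_exp2l // prime_gt1.
rewrite -expnMn leq_exp2r // mulSn mul2n -addnn leq_add //.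
exact: leq_trunc_div.
Qed.

Lemma card_le_fibers_seq (T : finType) (phi : T -> nat) (A : {set T}) c :
  (forall y, #|[set a in A | phi a == y]| <= c)%N ->
  (#|A| <= c * size (undup [seq phi a | a <- enum A]))%N.
Proof.
move=> h; set s := undup _.
have -> : #|A| = (\sum_(y <- s) \sum_(a in A) (phi a == y))%N.
  rewrite exchange_big /= -sum1_card; apply: eq_bigr => a aA.
  have -> : (\sum_(y <- s) (phi a == y) = count_mem (phi a) s)%N.
    by elim: (s) => [|y l IHl]; rewrite ?big_nil ?big_cons //= IHl eq_sym.
  rewrite count_uniq_mem ?undup_uniq // mem_undup map_f // mem_enum //.
have -> : (c * size s = \sum_(y <- s) c)%N by rewrite big_const_seq count_predT iter_addn_0.
apply: leq_sum => y _.
apply: leq_trans (h y); rewrite -big_mkcondr /= sum1dep_card.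
by apply/eq_leq/eq_card => a; rewrite !inE.
Qed.

Lemma card_le_cover (T : finType) (I : eqType) (V S : {set T}) (A : I -> {set T}) (s : seq I) :
    (forall a, a \in V -> a \in S \/ exists2 p, p \in s & a \in A p) ->
  (#|V| <= #|S| + \sum_(p <- s) #|A p|)%N.
Proof.
move=> h; apply: (@leq_trans #|S :|: \bigcup_(p <- s) A p|).
  apply/subset_leq_card/subsetP => a /h[aS|[p ps ap]]; rewrite inE ?aS //.
  apply/orP; right; elim: s ps {h} => //= q s IH; rewrite inE big_cons inE.
  by move=> /orP[/eqP <-|/IH ->]; rewrite ?ap ?orbT.
apply: (leq_trans (leq_card_setU _ _)); rewrite leq_add2l.
elim: s {h} => [|q s IH]; first by rewrite !big_nil cards0.
by rewrite !big_cons; apply: (leq_trans (leq_card_setU _ _)); rewrite leq_add2l.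
Qed.

Lemma sum_inv_square_le (P X : nat) : (0 < P)%N ->
  \sum_(p <- primes_upto X | (P < p)%N) (p%:R ^+ 2)^-1 <= P%:R^-1 :> rat.
Proof.
move=> P0; have pos (i : nat) : (0 < i)%N -> 0 < i%:R :> rat by move=> i0; rewrite ltr0n.
(* The difference 1/P - 1/X is the telescoping sum of 1/(x (x + 1)), which dominates 1/(x + 1) ^ 2;
   this sharper bound supports the induction on X. *)
suff H : \sum_(p <- primes_upto X | (P < p)%N) (p%:R ^+ 2)^-1 <=
    if (P < X)%N then P%:R^-1 - X%:R^-1 else 0 :> rat.
  apply: (le_trans H); case: ifP => [PX|_]; last by rewrite invr_ge0 ler0n.
  by rewrite gerBl invr_ge0 ler0n.
elim: X => [|X IH]; first by rewrite big_nil.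
rewrite /primes_upto -[X.+1]addn1 iotaD filter_cat big_cat /= add1n addn1.
have := lerD IH (_ : \sum_(i <- [seq p <- [:: X.+1] | prime p] | (P < i)%N) (i%:R ^+ 2)^-1
   <= if (P < X.+1)%N then (X.+1%:R ^+ 2)^-1 else 0 :> rat).
move=> /(_ _)/le_trans; apply.
  rewrite /=; case: ifP => _; rewrite ?big_cons big_nil; case: ifP => // _; rewrite ?addr0 //.
  by rewrite invr_ge0 exprn_ge0 ?ler0n.
rewrite ltnS; have [PX|XP] := ltnP P X.
  rewrite (ltnW PX); have X0 := pos X (leq_ltn_trans (leq0n _) PX).
  have -> : X.+1%:R = X%:R + 1 :> rat by rewrite -natr1.
  set x : rat := X%:R in X0 *.
  suff : ((x + 1) ^+ 2)^-1 <= x^-1 - (x + 1)^-1 by lra.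
  have -> : x^-1 - (x + 1)^-1 = (x * (x + 1))^-1 by field; lra.
  rewrite lef_pV2 ?posrE ?mulr_gt0 ?exprn_gt0; nra.
have [PX|PX] := leqP P X; last by rewrite addr0.
have {}PX : P = X by apply/eqP; rewrite eqn_leq PX XP.
have X0 := pos X (leq_trans P0 (_ : P <= X)%N); rewrite -PX in X0 *; move/(_ (leqnn _)): X0 => X0.
have -> : P.+1%:R = P%:R + 1 :> rat by rewrite -natr1.
set x : rat := P%:R in X0 *.
have -> : x^-1 - (x + 1)^-1 = (x * (x + 1))^-1 by field; lra.
rewrite add0r lef_pV2 ?posrE ?mulr_gt0 ?exprn_gt0; nra.
Qed.

(** A lower bound for tails that is uniform in [P] is the form of divergence that can be
    iterated. *)
Lemma prime_gt_tail (g : {poly int}) n :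
    g \is monic -> size g = n.+2 -> (0 < n <= 2)%N -> no_rat_root g ->
  exists2 E : nat, (0 < E)%N & forall P, exists X,
    E%:R^-1 <= \sum_(p <- primes_upto X | (P < p)%N && rooted g p) p%:R^-1 :> rat.
Proof.
move=> gm sg n02 nr; have /andP[n0 n2] := n02.
have [C0 C00 HC0] := rV_norm_bound n g.
have [C1 HC1] := box_rooted_count gm sg n2 nr C00 HC0.
exists (4 * C1.+1)%N => [|P]; first by [].
(* The term 2 ^ (n + 3) makes 2 ^ (n + 1) / P' <= 1/4, the share of the primes without a root; the
   factor 4 in [E] gives the same share to the others. *)
pose P' := (P + 2 ^ n.+3)%N.
pose c := (C0.+1 + n.+1)%N.
pose K := (2 * (n.+1 * c ^ P'.+1)).+1.
(* [K] and [c] gather the constants of the bound on smooth norms; [t] makes B = 2 ^ t exceed 2 K (t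
   + 1) ^ (P' + 1). *)
pose t := maxn (2 * K).+1 ((2 * P'.+2) ^ 2).
pose B := (2 ^ t)%N; pose X := (C0 * B ^ n.+1)%N.
exists X; rewrite leNgt; apply/negP => hsum.
(* If the tail were small, half of the vectors of the box would have a [P']-smooth
   norm; such norms take polylogarithmically many values, each one at most
   [O(B ^ n)] times. *)
pose s := [seq p <- primes_upto X | (P' < p)%N].
pose N (a : {ffun 'I_n.+1 -> 'I_B}) := rV_norm g (box_vec a).
pose V := [set a : {ffun 'I_n.+1 -> 'I_B} | box_vec a != 0].
pose A p := [set a : {ffun 'I_n.+1 -> 'I_B} | (box_vec a != 0)%R && (p%:Z %| N a)%Z].
pose Sm := [set a in V | all (fun p => p <= P')%N (primes `|N a|)].
have B0 : (0 < B)%N by rewrite expn_gt0.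
have NX a : (`|N a| <= X)%N.
  by apply: HC0 => i; rewrite mxE /= lez_nat ltnW ?ltn_ord.
have Nn0 a : a \in V -> (0 < `|N a|)%N.
  by rewrite inE lt0n absz_eq0; apply: contra => /eqP/(rV_norm_eq0 gm sg n2 nr)/eqP.
have cV : (B ^ n.+1 <= #|V|.+1)%N.
  have -> : (B ^ n.+1 = #|{: {ffun 'I_n.+1 -> 'I_B}}|)%N by rewrite card_ffun !card_ord.
  apply: (@leq_trans (#|V| + #|~: V|)); first by rewrite cardsC.
  rewrite -[#|V|.+1]addn1 leq_add2l.
  pose z : {ffun 'I_n.+1 -> 'I_B} := [ffun _ => Ordinal B0].
  rewrite -(cards1 z) subset_leq_card //; apply/subsetP => a; rewrite !inE negbK => /eqP a0.
  apply/eqP/box_vec_inj; rewrite a0; apply/rowP => i; by rewrite !mxE ffunE.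
have cov : (#|V| <= #|Sm| + \sum_(p <- s) #|A p|)%N.
  apply: card_le_cover => a aV; case: (boolP (a \in Sm)) => [|nS]; [by left | right].
  move: nS; rewrite inE aV /= => /allPn[p]; rewrite mem_primes => /and3P[pp Na pN] pP.
  exists p; last by move: aV; rewrite !inE => ->.
  rewrite mem_filter mem_primes_upto pp -ltnNge in pP *; rewrite pP /=.
  by apply: leq_trans (NX a); apply: dvdn_leq.
(* The factor 2 accounts for the sign of the norm. *)
have cSm : (#|Sm| <= 2 * (n.+1 * B ^ n) * (trunc_log 2 X).+1 ^ P'.+1)%N.
  have := @card_le_fibers_seq _ (fun a => `|N a|%N) Sm (2 * (n.+1 * B ^ n))%N.
  move=> /(_ _)/leq_trans; apply.
    move=> m; apply: (@leq_trans #|[set a | N a == m%:Z] :|: [set a | N a == - m%:Z]|).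
      apply/subset_leq_card/subsetP => a; rewrite !inE => /andP[_ /eqP <-].
      by move: (N a) => x; lia.
    apply: (leq_trans (leq_card_setU _ _)); rewrite mul2n -addnn leq_add //; exact: box_norm_fiber.
  rewrite leq_mul2l; apply/orP; right; apply: smooth_count; first exact: undup_uniq.
  move=> i; rewrite mem_undup => /mapP[a]; rewrite mem_enum inE => /andP[aV /allP h] ->.
  rewrite Nn0 // NX; split=> // p pp pN; apply: h.
  by rewrite mem_primes pp Nn0.
have tK : ((2 * K).+1 <= t)%N by rewrite leq_maxl.
have tP : (t.+1 ^ P'.+2 <= B)%N by apply: poly_le_exp2; rewrite leq_maxr.
have Xlog : ((trunc_log 2 X).+1 <= c * t.+1)%N.
  have : (X <= 2 ^ (C0 + t * n.+1))%N.
    by rewrite expnD expnM leq_mul // ltnW // ltn_expl.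
  move/(leq_trunc_log 2); rewrite trunc_expnK // => h.
  apply: leq_trans (_ : (C0 + t * n.+1).+1 <= _)%N; first by [].
  by rewrite /c; nia.
have cSm' : (#|Sm| <= (K.-1 * t.+1 ^ P'.+1) * B ^ n)%N.
  apply: (leq_trans cSm); rewrite /K /= -!mulnA leq_mul2l /= leq_mul2l /= mulnC.
  rewrite mulnA leq_mul2r -expnMn; apply/orP; right.
  by rewrite leq_exp2r.
have fin : (4 * (#|Sm| + 1) < 2 * B ^ n.+1)%N.
  have b1 : (0 < B ^ n)%N by rewrite expn_gt0 B0.
  have b2 : (0 < t.+1 ^ P'.+1)%N by rewrite expn_gt0.
  apply: (@leq_ltn_trans (4 * (K * t.+1 ^ P'.+1 * B ^ n))).
    by rewrite leq_mul2l /= /K mulSn mulnDl addnC leq_add // muln_gt0 b2 b1.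
  rewrite (expnS B) !mulnA ltn_pmul2r // (_ : 4 = 2 * 2)%N // -!mulnA ltn_pmul2l //.
  by apply: leq_trans tP; rewrite (expnS _ P'.+1) mulnA ltn_pmul2r // ltnS ltnW.
have sA : ((\sum_(p <- s) #|A p|)%N%:R : rat) <= (B ^ n.+1)%:R / 2.
  rewrite natr_sum (bigID (rooted g)) /=.
  have Pn : (0 < P')%N by rewrite /P' addn_gt0 expn_gt0 orbT.
  have h1 : \sum_(p <- s | rooted g p) (#|A p|%:R : rat) <= (B ^ n.+1)%:R / 4.
    have : \sum_(p <- s | rooted g p) (#|A p|%:R : rat) <=
        (C1 * B ^ n.+1)%:R * \sum_(p <- primes_upto X | (P < p)%N && rooted g p) p%:R^-1.
      rewrite mulr_sumr big_filter_cond big_seq_cond.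
      rewrite [X in _ <= X]big_seq_cond [X in _ <= X](bigID (fun p => P' < p)%N) /=.
      apply: ler_wpDr.
        by apply: sumr_ge0 => p _; rewrite mulr_ge0 ?invr_ge0 ?ler0n.
      rewrite [X in _ <= X](eq_bigl (fun p => (p \in primes_upto X) && ((P' < p)%N && rooted g p))); last first.
        move=> p; case: (p \in _) => //=; case: (rooted g p); rewrite ?andbF // !andbT.
        by case: (ltnP P' p); rewrite ?andbF ?andbT // => h; apply: leq_ltn_trans h; rewrite leq_addr.
      apply: ler_sum => p /andP[]; rewrite mem_primes_upto => /andP[pp pX] /andP[_ rp].
      rewrite ler_pdivlMr ?ltr0n ?prime_gt0 // -natrM ler_nat.
      apply: leq_trans (HC1 B p pp rp pX); rewrite leq_mul2r; apply/orP; right.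
      by apply/subset_leq_card/subsetP => a; rewrite !inE => /andP[].
    move/le_trans; apply; rewrite natrM -mulrA mulrCA ler_wpM2l ?ler0n //.
    apply: (@le_trans _ _ (C1%:R * (4 * C1.+1)%:R^-1)); first by rewrite ler_wpM2l ?ler0n // ltW.
    rewrite natrM invfM mulrCA -[X in _ <= X]mulr1 ler_wpM2l //.
    by rewrite ler_pdivrMr ?ltr0n // mul1r ler_nat.
  have h2 : \sum_(p <- s | ~~ rooted g p) (#|A p|%:R : rat) <= (B ^ n.+1)%:R / 4.
    have : \sum_(p <- s | ~~ rooted g p) (#|A p|%:R : rat) <=
        (2 ^ n.+1 * B ^ n.+1)%:R * \sum_(p <- primes_upto X | (P' < p)%N) (p%:R ^+ 2)^-1.
      rewrite mulr_sumr big_filter_cond big_seq_cond.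
      rewrite [X in _ <= X]big_seq_cond [X in _ <= X](bigID (rooted g)) /=.
      rewrite ler_wpDl //.
        by apply: sumr_ge0 => p _; rewrite mulr_ge0 ?invr_ge0 ?exprn_ge0 ?ler0n.
      rewrite [X in _ <= X](eq_bigl (fun p => (p \in primes_upto X) && ((P' < p)%N && ~~ rooted g p))); last first.
        by move=> p; rewrite andbA.
      apply: ler_sum => p /andP[]; rewrite mem_primes_upto => /andP[pp pX] /andP[_ rp].
      rewrite ler_pdivlMr ?exprn_gt0 ?ltr0n ?prime_gt0 // -natrX -natrM ler_nat.
      exact: box_inert_count.
    move/le_trans; apply; rewrite natrM mulrC mulrA [X in _ <= X]mulrC ler_wpM2r ?ler0n //.
    apply: (@le_trans _ _ (P'%:R^-1 * (2 ^ n.+1)%:R)).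
      by rewrite ler_wpM2r ?ler0n // sum_inv_square_le.
    rewrite mulrC ler_pdivrMr ?ltr0n // mulrC ler_pdivlMr // -natrM ler_nat.
    by rewrite /P' mulnC -[4%N]/(2 ^ 2)%N -expnD leq_addl.
  by apply: (le_trans (lerD h1 h2)); lra.
have : (#|V|%:R : rat) <= #|Sm|%:R + (B ^ n.+1)%:R / 2.
  by apply: (@le_trans _ _ ((#|Sm| + \sum_(p <- s) #|A p|)%N%:R)); rewrite ?ler_nat // natrD lerD2l.
have : ((B ^ n.+1)%:R : rat) <= #|V|%:R + 1 by rewrite natr1 ler_nat.
have : (4 * (#|Sm|%:R + 1) : rat) < 2 * (B ^ n.+1)%:R.
  by move: fin; rewrite -(ltr_nat rat) !natrM natrD.
lra.
Qed.

Lemma prod_succ_inv_ge (S : seq nat) : all prime S ->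
  1 + \sum_(p <- S) p%:R^-1 <= (\prod_(p <- S) p)%N%:R / (\prod_(p <- S) p.-1)%N%:R :> rat.
Proof.
elim: S => [|p S IH] /=; first by rewrite !big_nil divr1 addr0.
move=> /andP[pp /IH {}IH]; rewrite !big_cons !natrM.
have p1 : 1 < p%:R :> rat by rewrite ltr1n prime_gt1.
have e : p.-1%:R = p%:R - 1 :> rat by rewrite -subn1 natrB ?prime_gt0.
have s0 : 0 <= \sum_(p <- S) p%:R^-1 :> rat by apply: sumr_ge0 => q _; rewrite invr_ge0 ler0n.
rewrite invfM mulrACA e; set x : rat := p%:R in p1 *.
have h : 1 + x^-1 <= x / (x - 1).
  have -> : x / (x - 1) = 1 + (x - 1)^-1 by field; lra.
  by rewrite lerD2l lef_pV2 ?posrE; lra.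
have x0 : 0 <= x^-1 by rewrite invr_ge0; lra.
apply: (@le_trans _ _ ((1 + x^-1) * (1 + \sum_(p <- S) p%:R^-1))); first by nra.
by apply: ler_pM => //; lra.
Qed.

(** Tails starting beyond all primes already chosen are disjoint, and each adds at least 1/E to the
    sum of inverses, which bounds the product of p / (p - 1) from below. *)
Lemma sieving_rooted (g : {poly int}) n :
    g \is monic -> size g = n.+2 -> (0 < n <= 2)%N -> no_rat_root g ->
  sieving (rooted g).
Proof.
move=> gm sg n02 nr P E'.
have [E E0 HE] := prime_gt_tail gm sg n02 nr.
suff [S [uS pS SP hS]] : exists S : seq nat, [/\ uniq S, all prime S,
    {in S, forall p, (P < p)%N /\ rooted g p} & E'%:R <= \sum_(p <- S) p%:R^-1 :> rat].
  exists S; split=> //; have := prod_succ_inv_ge pS.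
  have D0 : (0 < \prod_(p <- S) p.-1)%N.
    rewrite big_seq_cond prodn_cond_gt0 // => p /andP[/(allP pS)/prime_gt1].
    by case: p => [|[]].
  rewrite ler_pdivlMr ?ltr0n // => h; rewrite -(ler_nat rat) natrM.
  by apply: le_trans h; rewrite ler_wpM2r ?ler0n //; lra.
suff H k : exists S : seq nat, [/\ uniq S, all prime S,
    {in S, forall p, (P < p)%N /\ rooted g p} & k%:R / E%:R <= \sum_(p <- S) p%:R^-1 :> rat].
  have [S [h1 h2 h3 h4]] := H (E' * E)%N; exists S; split=> //.
  by move: h4; rewrite natrM mulfK // pnatr_eq0 -lt0n.
elim: k => [|k [S [uS pS SP hS]]]; first by exists [::]; split; rewrite ?big_nil ?mul0r.
pose M := \max_(p <- S) p.
have [X HX] := HE (P + M)%N.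
exists ([seq p <- primes_upto X | (P + M < p)%N && rooted g p] ++ S); split.
- rewrite cat_uniq filter_uniq ?primes_upto_uniq // uS andbT /=.
  apply/hasPn => p pS'; rewrite mem_filter negb_and; apply/orP; left.
  rewrite negb_and -leqNgt (leq_trans _ (leq_addl _ _)) //.
  by rewrite /M (leq_bigmax_seq _) .
- rewrite all_cat pS andbT; apply/allP => p; rewrite mem_filter mem_primes_upto.
  by move=> /and3P[].
- move=> p; rewrite mem_cat => /orP[|/SP //]; rewrite mem_filter.
  move=> /andP[/andP[pP ->] _]; split=> //.
  by apply: leq_ltn_trans pP; rewrite leq_addr.
by rewrite big_cat big_filter /= -natr1 mulrDl mul1r addrC lerD.
Qed.

(** * Logarithmic sums over primes *)

Definition nlog (R : realType) (n : nat) : R := ln n%:R.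
Arguments nlog : clear implicits.

Lemma nlogM (R : realType) m n : (0 < m)%N -> (0 < n)%N ->
  nlog R (m * n) = nlog R m + nlog R n.
Proof. by move=> m0 n0; rewrite /nlog natrM lnM ?posrE ?ltr0n. Qed.

Lemma nlogX (R : realType) m n : (0 < m)%N -> nlog R (m ^ n) = n%:R * nlog R m.
Proof. by move=> m0; rewrite /nlog natrX lnXn ?ltr0n // mulr_natl. Qed.

Lemma nlog_ge0 (R : realType) n : 0 <= nlog R n.
Proof.
case: n => [|n]; last by rewrite ln_ge0 // ler1n.
by rewrite /nlog ln0.
Qed.

Lemma ler_nlog (R : realType) m n : (0 < m)%N -> (m <= n)%N -> nlog R m <= nlog R n.
Proof.
by move=> m0 mn; rewrite /nlog ler_ln ?posrE ?ltr0n ?ler_nat // (leq_trans m0).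
Qed.

Lemma nlog2_le1 (R : realType) : nlog R 2 <= 1.
Proof. by rewrite /nlog (_ : 2%:R = 1 + 1) // le_ln1Dx //; lra. Qed.

Lemma nlog_prod (R : realType) (I : eqType) (s : seq I) (F : I -> nat) :
  {in s, forall i, (0 < F i)%N} -> nlog R (\prod_(i <- s) F i) = \sum_(i <- s) nlog R (F i).
Proof.
elim: s => [|i s IH] H; first by rewrite !big_nil /nlog ln1.
have Hs : {in s, forall i, (0 < F i)%N} by move=> j js; apply: H; rewrite inE js orbT.
rewrite !big_cons nlogM ?H ?mem_head ?IH //.
by rewrite big_seq_cond prodn_cond_gt0 // => j /andP[/Hs].
Qed.

Lemma prod_pfactor_dvdn (s : seq nat) m :
  uniq s -> all prime s -> (\prod_(p <- s) p ^ logn p m %| m)%N.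
Proof.
elim: s => [|p s IH] /=; first by rewrite big_nil dvd1n.
move=> /andP[ps us] /andP[pp prs]; rewrite big_cons Gauss_dvd ?IH ?pfactor_dvdnn //.
apply: coprimeXl; elim: s ps prs {IH us} => [|q s IH]; first by rewrite big_nil coprimen1.
rewrite inE negb_or /= big_cons coprimeMr => /andP[pq ps] /andP[qp prs].
by rewrite IH // andbT coprimeXr // prime_coprime // dvdn_prime2.
Qed.

Lemma sum_logn_nlog_le (R : realType) (s : seq nat) m :
    uniq s -> all prime s -> (0 < m)%N ->
  \sum_(p <- s) (logn p m)%:R * nlog R p <= nlog R m.
Proof.
move=> us ps m0; have pos : {in s, forall p, (0 < p ^ logn p m)%N}.
  by move=> p /(allP ps) pp; rewrite expn_gt0 prime_gt0.
rewrite (eq_big_seq (fun p => nlog R (p ^ logn p m))); last first.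
  by move=> p /(allP ps) pp; rewrite nlogX ?prime_gt0.
rewrite -nlog_prod //; apply: ler_nlog.
  by rewrite big_seq_cond prodn_cond_gt0 // => p /andP[/pos].
by apply: dvdn_leq => //; apply: prod_pfactor_dvdn.
Qed.

Lemma nlog_le_sum_logn (R : realType) (s : seq nat) m :
    uniq s -> {subset primes m <= s} -> (0 < m)%N ->
  nlog R m <= \sum_(p <- s) (logn p m)%:R * nlog R p.
Proof.
move=> us sub m0.
rewrite (bigID (fun p => p \in primes m)) /= [X in _ + X]big1 ?addr0; last first.
  by move=> p; rewrite -logn_gt0 lt0n negbK => /eqP->; rewrite mul0r.
have e : perm_eq [seq p <- s | p \in primes m] (primes m).
  apply: uniq_perm; rewrite ?filter_uniq ?primes_uniq // => p.
  by rewrite mem_filter; apply/andP/idP => [[]|h] //; split=> //; apply: sub.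
rewrite -big_filter (perm_big _ e) /=.
have -> : nlog R m = nlog R (\prod_(p <- primes m) p ^ logn p m).
  by rewrite [in LHS](prod_prime_decomp m0) prime_decompE big_map.
rewrite nlog_prod; last by move=> p; rewrite mem_primes expn_gt0 => /and3P[/prime_gt0->].
rewrite big_seq [X in _ <= X]big_seq; apply: ler_sum => p.
by rewrite mem_primes => /and3P[/prime_gt0 p0 _ _]; rewrite nlogX.
Qed.

Lemma sum_nlog_primes_upto (R : realType) n :
  \sum_(p <- primes_upto n) nlog R p <= 2 * n%:R.
Proof.
have pos : {in primes_upto n, forall p, (0 < p)%N}.
  by move=> p; rewrite mem_primes_upto => /andP[/prime_gt0].
rewrite -(nlog_prod R (F := id)) //.
apply: (@le_trans _ _ (nlog R (4 ^ n))).
  by apply: ler_nlog (primorial_le n); rewrite big_seq_cond prodn_cond_gt0 // => p /andP[/pos].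
rewrite nlogX // (nlogX R 2 (isT : (0 < 2)%N)) mulrCA ler_wpM2l ?ler0n //.
by have := nlog2_le1 R; have := ler0n R n; nra.
Qed.

Lemma prime_count_nlog (R : realType) n : (prime_count n)%:R * nlog R n <= 14 * n%:R.
Proof.
have [n2|n2] := ltnP n 2.
  have -> : nlog R n = 0 by case: n n2 => [|[|]] // _; rewrite /nlog ?ln1 // ln0.
  by rewrite mulr0 mulr_ge0 ?ler0n.
have L0 : (0 < trunc_log 2 n)%N by rewrite trunc_log_gt0.
have : nlog R n <= (2 * trunc_log 2 n)%:R.
  apply: (@le_trans _ _ (nlog R (2 ^ (trunc_log 2 n).+1))).
    by apply: ler_nlog; [lia | apply/ltnW/trunc_log_ltn].
  rewrite nlogX //; apply: (@le_trans _ _ ((trunc_log 2 n).+1%:R * 1)).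
    by rewrite ler_wpM2l ?ler0n ?nlog2_le1.
  by rewrite mulr1 ler_nat; lia.
move=> h; apply: (@le_trans _ _ ((prime_count n)%:R * (2 * trunc_log 2 n)%:R)).
  by rewrite ler_wpM2l ?ler0n.
by rewrite -!natrM ler_nat; have := prime_count_upper n; lia.
Qed.

(** A weak Stirling bound, by induction from n (log (n + 1) - log n) <= 1. *)
Lemma sum_nlog_lower (R : realType) n :
  n%:R * nlog R n - n%:R <= \sum_(1 <= t < n.+1) nlog R t.
Proof.
elim: n => [|n IH]; first by rewrite big_nil mul0r subrr.
rewrite big_nat_recr //=.
have [->|n0] := posnP n; first by rewrite big_nil add0r /nlog ln1; lra.
have h : n%:R * (nlog R n.+1 - nlog R n) <= 1.
  have x0 : 0 < n%:R :> R by rewrite ltr0n.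
  have -> : nlog R n.+1 - nlog R n = ln (1 + n%:R^-1).
    rewrite /nlog -ln_div ?posrE ?ltr0n //; congr ln.
    by rewrite -natr1 mulrDl mul1r divff ?gt_eqF.
  apply: (@le_trans _ _ (n%:R * n%:R^-1)); last by rewrite divff ?gt_eqF.
  rewrite ler_wpM2l ?ler0n // le_ln1Dx //.
  by apply: lt_trans (_ : 0 < _); rewrite ?ltrN10 ?invr_gt0.
rewrite -[n.+1%:R]natr1; move: IH h; rewrite mulrBr; lra.
Qed.

(** * Pairs of lattice points and totally split primes *)

Lemma card_collisions (T : finType) (p : nat) (phi : T -> 'I_p) :
  (#|T| ^ 2 <= p * #|[set w : T * T | phi w.1 == phi w.2]|)%N.
Proof.
pose S c := #|[set u | phi u == c]|.
have -> : #|[set w : T * T | phi w.1 == phi w.2]| = (\sum_c S c ^ 2)%N.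
  rewrite -sum1_card (partition_big (fun w => phi w.1) predT) //=.
  apply: eq_bigr => c _; rewrite sum1dep_card -mulnn /S -cardsX.
  by apply: eq_card => -[u v]; rewrite !inE /=; apply/andP/andP => [[/eqP <- /eqP ->]|[/eqP -> /eqP ->]].
have -> : #|T| = (\sum_c S c)%N.
  by rewrite -sum1_card (partition_big phi predT) //=; apply: eq_bigr => c _; rewrite sum1dep_card.
rewrite -(leq_pmul2l (isT : (0 < 2)%N)).
have -> : (2 * (p * \sum_c S c ^ 2) = \sum_(c < p) \sum_(e < p) (S c ^ 2 + S e ^ 2))%N.
  rewrite [RHS](eq_bigr (fun c => p * S c ^ 2 + \sum_e S e ^ 2)%N); last first.
    by move=> c _; rewrite big_split /= sum_nat_const card_ord.
  by rewrite big_split /= -big_distrr /= sum_nat_const card_ord addnn -mul2n.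
rewrite -mulnn big_distrlr /= big_distrr /=; apply: leq_sum => c _.
rewrite big_distrr /=; apply: leq_sum => e _; exact: nat_Cauchy.
Qed.

Lemma square_cover (x : nat) : (0 < x)%N -> exists2 B, (x <= B ^ 2)%N & (B ^ 2 <= 4 * x)%N.
Proof.
move=> x0; have ex : exists B, (x <= B ^ 2)%N by exists x; rewrite -mulnn leq_pmulr.
case: (ex_minnP ex) => B hB Bmin; exists B => //.
case: B hB Bmin => [|[|B]] hB Bmin; rewrite ?exp0n // ?exp1n; first lia.
have : (B.+1 ^ 2 < x)%N by rewrite ltnNge; apply/negP => /Bmin; rewrite ltnn.
rewrite -!mulnn; nia.
Qed.

Definition xdiff B (w : ('I_B * 'I_B) * ('I_B * 'I_B)) : int :=
  (w.1.1 : nat)%:Z - (w.2.1 : nat)%:Z.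
Definition ydiff B (w : ('I_B * 'I_B) * ('I_B * 'I_B)) : int :=
  (w.1.2 : nat)%:Z - (w.2.2 : nat)%:Z.

(** The B ^ 2 points fall into p classes according to x - r y modulo p. Cauchy-Schwarz bounds the
    number of colliding pairs from below, and the added B ^ 2 accounts for the diagonal. *)
Lemma lattice_pairs_count (B p : nat) (r : int) : prime p ->
  (B ^ 4 <= p * (#|[set w : ('I_B * 'I_B) * ('I_B * 'I_B) |
       (w.1 != w.2) && (p%:Z %| (xdiff w - r * ydiff w)%R)%Z]| + B ^ 2))%N.
Proof.
move=> pp; set A := [set _ | _].
have p0 := prime_gt0 pp; have pn : p = p.-1.+1 by rewrite prednK.
pose f (u : 'I_B * 'I_B) : int := (u.1 : nat)%:Z - r * (u.2 : nat)%:Z.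
pose phi u : 'I_p.-1.+1 := inord `|(f u %% p)%Z|.
have cT : #|{: 'I_B * 'I_B}| = (B ^ 2)%N by rewrite card_prod !card_ord.
have h := card_collisions phi; rewrite cT -expnM in h; apply: (leq_trans h).
rewrite [X in (X * _ <= _)%N]prednK // leq_mul2l -cT; apply/orP; right.
pose D := [set w : ('I_B * 'I_B) * ('I_B * 'I_B) | w.1 == w.2].
have -> : #|{: 'I_B * 'I_B}| = #|D|.
  have inj : injective (fun u : 'I_B * 'I_B => (u, u)) by move=> u v [].
  rewrite -(card_imset predT inj); apply: eq_card => -[u v]; rewrite !inE /=.
  by apply/imsetP/eqP => [[w _ [-> ->]]|<-] //; exists u.
apply: leq_trans (leq_card_setU A D); apply/subset_leq_card/subsetP => -[u v].
rewrite !inE /= => /eqP/(congr1 val) /= e; case: (u == v); rewrite ?orbT ?orbF //=; move: e.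
have mp (x : int) : (`|(x %% p)%Z| < p.-1.+1)%N.
  have x1 : 0 <= (x %% p)%Z by rewrite modz_ge0 // eqz_nat -lt0n.
  have : (x %% p)%Z < p by rewrite ltz_pmod // ltz_nat.
  by rewrite -pn -{1}(gez0_abs x1) ltz_nat.
rewrite !inordK // => /(congr1 Posz).
rewrite !gez0_abs ?modz_ge0 ?eqz_nat -?lt0n // => /eqP; rewrite eqz_mod_dvd /f /xdiff /ydiff.
by congr (_ %| _)%Z; ring.
Qed.

(* By Cauchy-Schwarz, at least [B ^ 4 / p] of the pairs of points of the box have
   their difference in a given lattice of index [p].  There is no error term for
   [p > B], so that [x = B ^ 2] is allowed, whence the factor 1/2. *)
Lemma split_primes_nlog_sum (R : realType) (F : int -> int -> int) (d C0 : nat)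
    (T : pred nat) (rs : nat -> seq int) :
    (0 < d)%N -> (0 < C0)%N ->
    (forall x y, F x y = 0 -> x = 0 /\ y = 0) ->
    (forall x y B, `|x| <= B%:Z -> `|y| <= B%:Z -> (`|F x y| <= C0 * B ^ d)%N) ->
    (forall p, prime p -> T p -> size (rs p) = d /\ forall x y, F x y != 0 ->
       (count (fun r => (p%:Z %| (x - r * y)%R)%Z) (rs p) <= logn p `|F x y|)%N) ->
  exists C : R, forall x, (0 < x)%N ->
    \sum_(p <- primes_upto x | T p) nlog R p / p%:R <= nlog R x / 2 + C.
Proof.
move=> d0 C00 F0 Fb HT.
exists (nlog R C0 + 3) => x x0.
(* With B about the square root of x, d log B is about (d / 2) log x, while the diagonal terms cost
   B ^ 2 times the sum of log p, which is O(B ^ 4). *)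
have [B xB Bx] := square_cover x0.
have B0 : (0 < B)%N by case: B xB {Bx} => //; rewrite exp0n // leqn0 => /eqP xx; rewrite xx in x0.
pose W := [set w : ('I_B * 'I_B) * ('I_B * 'I_B) | w.1 != w.2].
pose dx := @xdiff B; pose dy := @ydiff B.
have Fn0 w : w \in W -> F (dx w) (dy w) != 0.
  rewrite inE; apply: contra => /eqP/F0[]; rewrite /dx /dy /xdiff /ydiff => /eqP; rewrite subr_eq0 => e1.
  move=> /eqP; rewrite subr_eq0; case: w e1 => -[a b] [a' b'] /=.
  by rewrite !eqz_nat => /eqP/val_inj -> /eqP/val_inj ->.
have dB (a b : 'I_B) : `|(a : nat)%:Z - (b : nat)%:Z| <= B%:Z.
  by have := ltn_ord a; have := ltn_ord b; move: (a : nat) (b : nat); clear; lia.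
have FB w : (`|F (dx w) (dy w)| <= C0 * B ^ d)%N by apply: Fb; apply: dB.
set s := [seq p <- primes_upto x | T p].
have us : uniq s by rewrite !filter_uniq ?iota_uniq.
have sP p : p \in s -> [/\ prime p, T p & (p <= x)%N].
  by rewrite mem_filter mem_primes_upto => /and3P[].
have ps : all prime s by apply/allP => p /sP[].
have upper : \sum_(w in W) nlog R `|F (dx w) (dy w)| <= (B ^ 4)%:R * (nlog R C0 + d%:R * nlog R B).
  apply: (@le_trans _ _ (\sum_(w in W) nlog R (C0 * B ^ d))).
    by apply: ler_sum => w wW; apply: ler_nlog; rewrite ?FB // absz_gt0 Fn0.
  rewrite sumr_const -[X in X <= _]mulr_natl nlogM ?expn_gt0 ?B0 // nlogX //.
  rewrite ler_wpM2r ?addr_ge0 ?mulr_ge0 ?nlog_ge0 ?ler0n // ler_nat.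
  by apply: (leq_trans (max_card _)); rewrite !card_prod !card_ord; apply/eq_leq; ring.
have lower p : p \in s -> d%:R * ((B ^ 4)%:R / p%:R - (B ^ 2)%:R) <=
    \sum_(w in W) (logn p `|F (dx w) (dy w)|)%:R :> R.
  move=> /sP[pp Tp _]; have [szr Hr] := HT p pp Tp.
  apply: (@le_trans _ _ (\sum_(w in W) (count (fun r => (p%:Z %| (dx w - r * dy w)%R)%Z) (rs p))%:R)); last first.
    by apply: ler_sum => w wW; rewrite ler_nat Hr ?Fn0.
  rewrite -natr_sum.
  have -> : (\sum_(w in W) count (fun r => (p%:Z %| (dx w - r * dy w)%R)%Z) (rs p) =
      \sum_(r <- rs p) #|[set w in W | (p%:Z %| (dx w - r * dy w)%R)%Z]|)%N.
    transitivity (\sum_(w in W) \sum_(r <- rs p) (p%:Z %| (dx w - r * dy w)%R)%Z)%N.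
      by apply: eq_bigr => w _; elim: (rs p) => [|r l IH]; rewrite ?big_nil ?big_cons //= IH.
    rewrite exchange_big /=; apply: eq_bigr => r _.
    rewrite -big_mkcondr /= sum1dep_card; apply: eq_card => w; by rewrite !inE.
  rewrite natr_sum -szr mulr_natl.
  rewrite -[X in X <= _]addr0 -iter_addr -[size _](count_predT) -big_const_seq; apply: ler_sum => r _.
  rewrite lerBlDr ler_pdivrMr ?ltr0n ?prime_gt0 // -natrD -natrM ler_nat mulnC.
  have -> : [set w in W | (p%:Z %| (dx w - r * dy w)%R)%Z] = [set w : ('I_B * 'I_B) * ('I_B * 'I_B) |
       (w.1 != w.2) && (p%:Z %| (xdiff w - r * ydiff w)%R)%Z].
    by apply/setP => w; rewrite !inE.
  exact: lattice_pairs_count.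
(* After weighting by log p and exchanging the sums, each pair contributes at most log |F|. *)
have key : \sum_(p <- s) nlog R p * (d%:R * ((B ^ 4)%:R / p%:R - (B ^ 2)%:R)) <=
    (B ^ 4)%:R * (nlog R C0 + d%:R * nlog R B).
  apply: le_trans upper.
  apply: (@le_trans _ _ (\sum_(p <- s) nlog R p * \sum_(w in W) (logn p `|F (dx w) (dy w)|)%:R)).
    by rewrite big_seq [X in _ <= X]big_seq; apply: ler_sum => p /lower h; rewrite ler_wpM2l ?nlog_ge0.
  under eq_bigr do rewrite mulr_sumr.
  rewrite exchange_big /=; apply: ler_sum => w wW.
  under eq_bigr do rewrite mulrC.
  by apply: sum_logn_nlog_le; rewrite ?absz_gt0 ?Fn0.
have theta : \sum_(p <- s) nlog R p <= 2 * (B ^ 2)%:R.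
  apply: (@le_trans _ _ (\sum_(p <- primes_upto x) nlog R p)).
    rewrite big_filter [X in _ <= X](bigID T) /= lerDl.
    by apply: sumr_ge0 => p _; apply: nlog_ge0.
  by apply: (le_trans (sum_nlog_primes_upto R x)); rewrite ler_wpM2l ?ler_nat.
rewrite -big_filter -/s.
set S := \sum_(p <- s) _.
have e : \sum_(p <- s) nlog R p * (d%:R * ((B ^ 4)%:R / p%:R - (B ^ 2)%:R)) =
   d%:R * ((B ^ 4)%:R * S - (B ^ 2)%:R * \sum_(p <- s) nlog R p).
  rewrite /S !mulr_sumr -sumrB mulr_sumr; apply: eq_bigr => p _; ring.
rewrite {}e in key.
have b4 : (B ^ 4)%:R = (B ^ 2)%:R ^+ 2 :> R by rewrite -natrX -expnM.
have b0 : 0 < (B ^ 2)%:R :> R by rewrite ltr0n expn_gt0 B0.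
have d1 : 1 <= d%:R :> R by rewrite ler1n.
have lB : 2 * nlog R B <= nlog R x + 2.
  rewrite -(nlogX R 2 B0); apply: (@le_trans _ _ (nlog R (4 * x))).
    by apply: ler_nlog; rewrite // expn_gt0 B0.
  rewrite nlogM // (nlogX R 2 (isT : (0 < 2)%N)); have := nlog2_le1 R; lra.
have lC := nlog_ge0 R C0; have lB0 := nlog_ge0 R B.
rewrite b4 in key; set b := (B ^ 2)%:R in key b0 theta.
suff : S <= nlog R C0 + nlog R B + 2 by lra.
have h1 : d%:R * (b ^+ 2 * S - b * (2 * b)) <= b ^+ 2 * (d%:R * (nlog R C0 + nlog R B)).
  apply: (@le_trans _ _ (d%:R * (b ^+ 2 * S - b * \sum_(p <- s) nlog R p))).
    by rewrite ler_pM2l ?lerD2l ?lerN2 ?ler_pM2l //; lra.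
  apply: (le_trans key); rewrite ler_pM2l ?exprn_gt0 //; nra.
have h2 : d%:R * (b ^+ 2 * (S - 2)) <= d%:R * (b ^+ 2 * (nlog R C0 + nlog R B)) by lra.
rewrite ler_pM2l in h2; last by lra.
by rewrite ler_pM2l ?exprn_gt0 // in h2; lra.
Qed.

(** * Large prime divisors of polynomial values *)

Lemma horner_taylor1 (H : {poly int}) (x h : int) :
  exists V, H.[x + h] = H.[x] + h * H^`().[x] + h ^+ 2 * V.
Proof.
elim/poly_ind: H => [|H c [V IH]].
  by exists 0; rewrite deriv0 !horner0; ring.
rewrite derivD derivM derivX derivC !(hornerD, hornerM, hornerX, hornerC) IH.
by exists (V * (x + h) + H^`().[x]); ring.
Qed.

Lemma PoszX (t i : nat) : (t ^ i)%:Z = t%:Z ^+ i.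
Proof. by elim: i => // i IH; rewrite expnS exprS PoszM IH. Qed.

Lemma horner_nat_bound (H : {poly int}) : exists2 A : nat, (0 < A)%N &
  forall t : nat, (0 < t)%N -> (`|H.[t%:Z]| <= A * t ^ (size H).-1)%N.
Proof.
pose A := \sum_(i < size H) `|H`_i|.
have A0 : 0 <= A by apply: sumr_ge0.
exists `|A|.+1 => // t t0; rewrite -lez_nat abszE horner_coef.
apply: (le_trans (ler_norm_sum _ _ _)).
apply: (@le_trans _ _ (A * (t ^ (size H).-1)%:Z)); last first.
  by rewrite PoszM ler_wpM2r //; move: A0; clear; case: A => //= a _; lia.
rewrite /A mulr_suml; apply: ler_sum => i _; rewrite normrM ler_wpM2l //.
have -> : `|t%:Z ^+ i| = (t ^ i)%:Z by rewrite ger0_norm ?exprn_ge0 // PoszX.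
by rewrite lez_nat leq_pexp2l // -ltnS prednK // (leq_ltn_trans _ (ltn_ord i)).
Qed.

(** An aligned window of p ^ j integers contains at most one solution above each root modulo p,
    because the roots are simple. *)
Lemma root_pfactor_count (H : {poly int}) (p j K t0 : nat) :
    prime p -> (p%:Z %| H.[t0%:Z])%Z ->
    (forall t : nat, (0 < t)%N -> (p%:Z %| H.[t%:Z])%Z -> ~~ (p%:Z %| H^`().[t%:Z])%Z) ->
    (0 < t0)%N -> (0 < j)%N ->
  (count (fun t => (p ^ j)%:Z %| H.[t%:Z])%Z (iota 1 K) <= (size H).-1 * (K %/ p ^ j).+1)%N.
Proof.
move=> pp Ht0 Hd t00 j0; set s := iota 1 K; pose q := (p ^ j)%N.
have q0 : (0 < q)%N by rewrite expn_gt0 prime_gt0.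
pose Hp : {poly 'F_p} := map_poly intr H.
have hev t : Hp.[t%:R] = H.[t%:Z]%:~R by rewrite -[t%:R]/((t%:Z)%:~R) horner_map.
have dv (x : int) : (p%:Z %| x)%Z = (x%:~R == 0 :> 'F_p) by apply: dvdz_pcharf; apply: pchar_Fp.
(* If H vanished identically modulo p, so would its derivative, against simplicity at [t0]. *)
have Hp0 : Hp != 0.
  apply/negP => /eqP h0; have := Hd t0 t00 Ht0; rewrite dv.
  have -> : H^`().[t0%:Z]%:~R = Hp^`().[t0%:R] :> 'F_p.
    by rewrite /Hp deriv_map -[t0%:R]/((t0%:Z)%:~R) horner_map.
  by rewrite h0 deriv0 horner0 eqxx.
have szHp : (size Hp <= size H)%N by apply: size_poly.
pose rs := enum [pred r : 'F_p | root Hp r].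
have srs : (size rs <= (size H).-1)%N.
  have szH : (0 < size H)%N by apply: leq_trans szHp; rewrite size_poly_gt0.
  rewrite -ltnS (prednK szH); apply: leq_trans szHp; apply: max_poly_roots => //.
    by apply/allP => x; rewrite mem_enum.
  exact: enum_uniq.
pose S := [seq t <- s | ((p ^ j)%:Z %| H.[t%:Z])%Z].
have dvp t : t \in S -> (p%:Z %| H.[t%:Z])%Z.
  rewrite mem_filter => /andP[h _]; apply: dvdz_trans h.
  by rewrite dvdzE /= dvdn_exp.
pose phi t := ((t%:R : 'F_p), (t %/ q)%N).
(* Hensel: a simple root modulo [p] lifts to at most one root modulo [p ^ j]. *)
have inj : {in S &, injective phi}.
  move=> t t' tS tS' [e1 e2].
  have [t1 tK] : (0 < t)%N /\ (0 < t')%N.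
    by move: tS tS'; rewrite !mem_filter !mem_iota => /and3P[_ -> _] /and3P[_ -> _].
  have [V] := horner_taylor1 H t%:Z (t'%:Z - t%:Z); rewrite addrC subrK => hT.
  have hp : (p%:Z %| t'%:Z - t%:Z)%Z.
    by rewrite dv rmorphB /= -!pmulrn e1 subrr.
  have hq : (q%:Z %| t'%:Z - t%:Z)%Z.
    have : (q%:Z %| (t'%:Z - t%:Z) * (H^`().[t%:Z] + (t'%:Z - t%:Z) * V))%Z.
      have -> : (t'%:Z - t%:Z) * (H^`().[t%:Z] + (t'%:Z - t%:Z) * V) = H.[t'%:Z] - H.[t%:Z].
        by rewrite hT; ring.
      by move: tS tS'; rewrite !mem_filter => /andP[h _] /andP[h' _]; apply: rpredB.
    rewrite Gauss_dvdzl // /coprimez /gcdz /=; apply/eqP; congr Posz; apply/eqP.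
    rewrite -/(coprime _ _) coprimeXl // prime_coprime //.
    apply: contra (Hd t t1 (dvp t tS)) => h.
    have := h : (p%:Z %| H^`().[t%:Z] + (t'%:Z - t%:Z) * V)%Z.
    by rewrite (rpredDr _ (dvdz_mulr _ hp)).
  have := distz_of_eq_divn q0 (esym e2).
  have := divn_eq t q; have := divn_eq t' q; rewrite e2.
  have := ltn_pmod t q0; have := ltn_pmod t' q0 => l1 l2 d1 d2 _.
  have : `|t'%:Z - t%:Z| < q%:Z by rewrite d1 d2; move: l1 l2; clear; lia.
  have [e _|ne] := eqVneq t'%:Z t%:Z; first by case: e.
  move=> lt; have := hq; rewrite dvdzE => /dvdn_leq.
  rewrite absz_gt0 subr_eq0 => /(_ ne); rewrite leqNgt -ltz_nat abszE lt //.
rewrite -size_filter -/S -(size_map phi).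
apply: (@leq_trans (size [seq (r, i) | r <- rs, i <- iota 0 (K %/ q).+1])); last first.
  by rewrite size_allpairs size_iota leq_mul2r srs orbT.
apply: uniq_leq_size; first by rewrite map_inj_in_uniq // !filter_uniq ?iota_uniq.
move=> x /mapP[t tS ->]; apply: allpairs_f.
  by rewrite mem_enum inE rootE hev -dv dvp.
rewrite mem_iota /= ltnS leq_div2r //.
by move: tS; rewrite mem_filter mem_iota add1n ltnS => /and3P[].
Qed.

Lemma sum_inv_pow_le (R : realType) (p J : nat) : (1 < p)%N ->
  \sum_(j < J) ((p ^ j.+1)%:R)^-1 <= (p%:R - 1)^-1 :> R.
Proof.
move=> p1; have x1 : 1 < p%:R :> R by rewrite ltr1n.
suff -> : \sum_(j < J) ((p ^ j.+1)%:R)^-1 = (p%:R - 1)^-1 * (1 - ((p ^ J)%:R)^-1) :> R.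
  rewrite -[X in _ <= X]mulr1 ler_wpM2l //; first by rewrite invr_ge0 subr_ge0 ltW.
  by rewrite gerBl invr_ge0 ler0n.
elim: J => [|J IH]; first by rewrite big_ord0 expn0 invr1 subrr mulr0.
rewrite big_ord_recr /= IH expnS natrM.
have y0 : (p ^ J)%:R != 0 :> R by rewrite pnatr_eq0 -lt0n expn_gt0 (ltnW p1).
field; rewrite y0 /=; apply/andP; split; apply/eqP; lra.
Qed.

Lemma logn_le_count (p m J : nat) : prime p -> (0 < m)%N -> (logn p m <= J)%N ->
  (logn p m <= \sum_(j < J) (p ^ j.+1 %| m))%N.
Proof.
move=> pp m0 lJ; rewrite -{1}(card_ord (logn p m)) -sum1_card.
rewrite (big_ord_widen J (fun=> 1%N)) // big_mkcond /=; apply: leq_sum => j _.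
by case: ifP => // jl; rewrite pfactor_dvdn // jl.
Qed.

Lemma ler_sum_subseq (R : realType) (s s' : seq nat) (F : nat -> R) :
    uniq s -> uniq s' -> {subset s <= s'} -> (forall i, 0 <= F i) ->
  \sum_(i <- s) F i <= \sum_(i <- s') F i.
Proof.
move=> us us' sub F0; rewrite [X in _ <= X](bigID (fun i => i \in s)) /=.
have e : perm_eq [seq i <- s' | i \in s] s.
  apply: uniq_perm; rewrite ?filter_uniq // => i.
  by rewrite mem_filter; apply/andP/idP => [[]|h] //; split=> //; apply: sub.
by rewrite -[\sum_(i <- s' | i \in s) F i]big_filter (perm_big _ e) /= lerDl sumr_ge0.
Qed.

(** After division by D, the main terms K l and (11/20) K l leave (9/20) K l. The O(K) terms take at
    most a tenth of K l by the lower bound on l, so (35/100) K l <= (D + 1) q l. *)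
Lemma count_from_log_inequality (R : realFieldType) (D K l a C q P : R) :
    1 <= D -> 1 <= K -> 0 <= a -> 0 <= q -> 0 <= P -> P <= K -> P * l <= 14 * K ->
    10 * (1 + 11/10 * `|C| + a + 14 * D) + a <= l ->
    D * (K * l - K) <= 11/10 * (D * K * (l / 2 + C)) + P * (D * (a + D * l))
      + q * (D * (a + D * l)) ->
  K <= 3 * (D + 1) * q.
Proof.
move=> D1 K1 a0 q0 P0 PK Pl hl.
have C0 := normr_ge0 C; have CC := ler_norm C.
set C' := 1 + 11/10 * `|C| + a + 14 * D in hl.
have l0 : 0 < l by rewrite /C' in hl; lra.
have D0 : 0 < D by lra.
have -> : 11/10 * (D * K * (l / 2 + C)) + P * (D * (a + D * l)) + q * (D * (a + D * l)) =
  D * (11/10 * (K * (l / 2 + C)) + (P + q) * (a + D * l)) by ring.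
rewrite ler_pM2l // => h.
have h1 : P * a <= K * a by rewrite ler_wpM2r.
have h2 : D * (P * l) <= D * (14 * K) by rewrite ler_wpM2l // ltW.
have h3 : K * C <= K * `|C| by rewrite ler_wpM2l //; lra.
have h4 : K * (10 * C') <= K * l by rewrite ler_wpM2l //; lra.
have h5 : q * a <= q * l by rewrite ler_wpM2l //; rewrite /C' in hl; lra.
have h6 : l * (35/100 * K) <= l * ((D + 1) * q) by rewrite /C' in h4; lra.
rewrite ler_pM2l // in h6; lra.
Qed.

(** The product of the H(t) for t <= K has logarithm at least D (K log K - K). Simplicity of the
    roots controls prime powers, and p >= 11 gives p / (p - 1) <= 11/10, so primes up to K take
    about 11/20 of it. A prime beyond K contributes only O(log K), hence there are at least a
    constant times K of these. *)
Lemma large_prime_divisors (R : realType) (H : {poly int}) (T : pred nat) :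
    (1 < size H)%N ->
    (exists C : R, forall x, (0 < x)%N ->
       \sum_(p <- primes_upto x | T p) nlog R p / p%:R <= nlog R x / 2 + C) ->
    (forall t : nat, (0 < t)%N -> (t ^ (size H).-1 <= `|H.[t%:Z]|)%N) ->
    (forall t p : nat, (0 < t)%N -> prime p -> (p%:Z %| H.[t%:Z])%Z ->
       [/\ T p, (11 <= p)%N & ~~ (p%:Z %| H^`().[t%:Z])%Z]) ->
  exists c K0 : nat, forall K, (K0 <= K)%N -> exists Q : seq nat,
    [/\ uniq Q, all prime Q, {in Q, forall q, (K < q)%N /\
        exists t : nat, (0 < t <= K)%N /\ (q%:Z %| H.[t%:Z])%Z}
      & (K <= c * size Q)%N].
Proof.
move=> szH [C HC] Hlow Hp; set D := (size H).-1 in Hlow.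
have D0 : (0 < D)%N by rewrite -ltnS prednK // ltnW.
have [A A0 HA] := horner_nat_bound H; rewrite -/D in HA.
pose a := nlog R A; have a0 : 0 <= a := nlog_ge0 R A.
pose C' : R := 1 + 11/10 * `|C| + a + 14 * D%:R.
pose L := 10 * C' + a.
exists (3 * D.+1)%N, (Num.bound (expR L)).+1 => K KK.
have K0 : (0 < K)%N by apply: leq_trans KK.
pose l := nlog R K.
have lL : L <= l.
  rewrite /l /nlog -[L]expRK ler_ln ?posrE ?expR_gt0 ?ltr0n //.
  apply: (@le_trans _ _ (Num.bound (expR L))%:R); last by rewrite ler_nat ltnW.
  by apply/ltW/archi_boundP/expR_ge0.
pose Mt (t : nat) := `|H.[t%:Z]|%N.
have Mt0 t : (0 < t)%N -> (0 < Mt t)%N.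
  by move=> t0; apply: leq_trans (Hlow t t0); rewrite expn_gt0 t0.
pose MM := (A * K ^ D)%N.
have MM0 : (0 < MM)%N by rewrite muln_gt0 A0 expn_gt0 K0.
have MtM t : (0 < t <= K)%N -> (Mt t <= MM)%N.
  move=> /andP[t0 tK]; apply: (leq_trans (HA t t0)).
  by rewrite leq_mul2l leq_exp2r // tK orbT.
have lMM : nlog R MM = a + D%:R * l by rewrite nlogM ?expn_gt0 ?K0 // nlogX.
pose I := iota 1 K.
have II t : t \in I -> (0 < t <= K)%N by rewrite mem_iota add1n ltnS.
pose PP := undup (flatten [seq primes (Mt t) | t <- I]).
have uPP : uniq PP by apply: undup_uniq.
have PPP p : p \in PP -> exists t : nat, [/\ prime p, (0 < t <= K)%N & (p%:Z %| H.[t%:Z])%Z].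
  rewrite mem_undup => /flattenP[_ /mapP[t tI ->]]; rewrite mem_primes => /and3P[pp _ pd].
  by exists t; split=> //; apply: II.
pose Q := [seq p <- PP | (K < p)%N].
exists Q; split.
- by rewrite filter_uniq.
- by apply/allP => p; rewrite mem_filter => /andP[_ /PPP[t []]].
- move=> p; rewrite mem_filter => /andP[Kp /PPP[t [pp tK pd]]]; split=> //.
  by exists t.
pose S := [seq p <- PP | (p <= K)%N].
have uS : uniq S by rewrite filter_uniq.
have SP p : p \in S -> [/\ prime p, T p, (11 <= p)%N & (p <= K)%N].
  rewrite mem_filter => /andP[pK /PPP[t [pp /andP[t0 _] pd]]].
  by have [Tp p11 _] := Hp t p t0 pp pd.
pose V p := (\sum_(t <- I) logn p (Mt t))%N.
have s1 : D%:R * (K%:R * l - K%:R) <= \sum_(t <- I) nlog R (Mt t).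
  apply: (@le_trans _ _ (\sum_(t <- I) D%:R * nlog R t)).
    rewrite -mulr_sumr ler_wpM2l ?ler0n //.
    by have := sum_nlog_lower R K; rewrite /index_iota subSS subn0.
  rewrite big_seq [X in _ <= X]big_seq; apply: ler_sum => t /II/andP[t0 _].
  by rewrite -nlogX // ler_nlog ?expn_gt0 ?t0 // Hlow.
have s2 : \sum_(t <- I) nlog R (Mt t) <= \sum_(p <- PP) (V p)%:R * nlog R p.
  apply: (@le_trans _ _ (\sum_(t <- I) \sum_(p <- PP) (logn p (Mt t))%:R * nlog R p)).
    rewrite big_seq [X in _ <= X]big_seq; apply: ler_sum => t tI.
    have /andP[t0 _] := II t tI; apply: nlog_le_sum_logn; rewrite ?Mt0 //.
    move=> p pt; rewrite mem_undup; apply/flattenP; exists (primes (Mt t)) => //.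
    by apply/mapP; exists t.
  rewrite exchange_big /=; apply: ler_sum => p _.
  by rewrite -mulr_suml -natr_sum.
have cnt p j : p \in PP -> (0 < j)%N ->
    (\sum_(t <- I) (p ^ j %| Mt t) <= D * (K %/ p ^ j).+1)%N.
  move=> /PPP[t [pp /andP[t0 _] pd]] j0.
  have Hd (t' : nat) : (0 < t')%N -> (p%:Z %| H.[t'%:Z])%Z -> ~~ (p%:Z %| H^`().[t'%:Z])%Z.
    by move=> t'0 /(Hp _ _ t'0 pp)[].
  apply: leq_trans (root_pfactor_count K pp pd Hd t0 j0).
  by rewrite -/I; elim: (I) => [|t' I' IH]; rewrite ?big_nil ?big_cons //= leq_add2l.
(* A prime beyond K divides at most D of the values, and each of them is at most [MM]. *)
have sQ p : p \in Q -> (V p)%:R * nlog R p <= D%:R * (a + D%:R * l).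
  rewrite mem_filter => /andP[Kp pP]; have [_ [pp _ _]] := PPP p pP.
  rewrite -lMM natr_sum mulr_suml.
  apply: (@le_trans _ _ (\sum_(t <- I) (p ^ 1 %| Mt t)%:R * nlog R MM)).
    rewrite big_seq [X in _ <= X]big_seq; apply: ler_sum => t /II tK.
    have /andP[t0 _] := tK; rewrite expn1; case: (boolP (p %| Mt t)%N) => [h|h].
      rewrite mul1r -nlogX ?prime_gt0 //; apply: ler_nlog; first by rewrite expn_gt0 prime_gt0.
      by apply: leq_trans (MtM t tK); apply: dvdn_leq; rewrite ?Mt0 ?pfactor_dvdnn.
    by rewrite logn_coprime ?mul0r // prime_coprime.
  rewrite -mulr_suml -natr_sum ler_wpM2r ?nlog_ge0 // ler_nat.
  by apply: (leq_trans (cnt p 1%N pP isT)); rewrite expn1 divn_small // muln1.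
(* The counts D (K / p ^ j + 1) are summed over j <= J: the geometric part gives K / (p - 1), and
   the terms 1 give J log p <= log MM. *)
have sS p : p \in S -> (V p)%:R * nlog R p <=
    11/10 * (D%:R * K%:R * (nlog R p / p%:R)) + D%:R * (a + D%:R * l).
  move=> pS; have [pp Tp p11 pK] := SP p pS.
  have pP : p \in PP by move: pS; rewrite mem_filter => /andP[].
  pose J := trunc_log p MM; have p1 := prime_gt1 pp.
  have VJ : (V p <= \sum_(j < J) D * (K %/ p ^ j.+1).+1)%N.
    apply: (@leq_trans (\sum_(t <- I) \sum_(j < J) (p ^ j.+1 %| Mt t))%N).
      rewrite /V big_seq [X in (_ <= X)%N]big_seq; apply: leq_sum => t /II tK.
      have /andP[t0 _] := tK; apply: logn_le_count => //; first exact: Mt0.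
      apply: trunc_log_max => //; apply: leq_trans (MtM t tK).
      by apply: dvdn_leq; rewrite ?Mt0 ?pfactor_dvdnn.
    by rewrite exchange_big /=; apply: leq_sum => j _; apply: cnt.
  have x0 : 0 < p%:R :> R by rewrite ltr0n prime_gt0.
  have x11 : 11 <= p%:R :> R by rewrite ler_nat.
  have Jl : J%:R * nlog R p <= a + D%:R * l.
    by rewrite -lMM -nlogX ?prime_gt0 // ler_nlog ?expn_gt0 ?prime_gt0 // trunc_logP.
  have VR : (V p)%:R <= D%:R * (K%:R * (p%:R - 1)^-1 + J%:R) :> R.
    apply: (@le_trans _ _ (\sum_(j < J) D * (K %/ p ^ j.+1).+1)%N%:R); first by rewrite ler_nat.
    rewrite -big_distrr /= natrM ler_wpM2l ?ler0n //.
    apply: (@le_trans _ _ (K%:R * \sum_(j < J) ((p ^ j.+1)%:R)^-1 + J%:R)); last first.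
      by rewrite lerD2r ler_wpM2l ?ler0n // sum_inv_pow_le.
    have -> : J%:R = \sum_(j < J) 1 :> R by rewrite sumr_const card_ord.
    rewrite natr_sum mulr_sumr -big_split /=; apply: ler_sum => j _.
    rewrite -natr1 lerD2r ler_pdivlMr ?ltr0n ?expn_gt0 ?prime_gt0 // -natrM ler_nat.
    exact: leq_trunc_div.
  have np := nlog_ge0 R p.
  have inv11 : (p%:R - 1)^-1 <= 11/10 * (p%:R)^-1 :> R.
    have x1 : 0 < p%:R - 1 :> R by lra.
    rewrite -[X in X <= _]mul1r ler_pdivrMr // mulrAC ler_pdivlMr //; lra.
  apply: (@le_trans _ _ (D%:R * (K%:R * (11/10 * (p%:R)^-1) + J%:R) * nlog R p)).
    rewrite ler_wpM2r //; apply: (le_trans VR); rewrite ler_wpM2l ?ler0n // lerD2r.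
    by rewrite ler_wpM2l ?ler0n.
  have -> : D%:R * (K%:R * (11/10 * (p%:R)^-1) + J%:R) * nlog R p =
     11/10 * (D%:R * K%:R * (nlog R p / p%:R)) + D%:R * (J%:R * nlog R p) by ring.
  by rewrite lerD2l ler_wpM2l ?ler0n.
have pS : (size S <= prime_count K)%N.
  apply: uniq_leq_size => // p /SP[pp _ _ pK]; by rewrite mem_primes_upto pp.
have sumS : \sum_(p <- S) nlog R p / p%:R <= l / 2 + C.
  apply: le_trans (HC K K0); rewrite -[X in _ <= X]big_filter; apply: ler_sum_subseq => //.
  - by rewrite !filter_uniq ?iota_uniq.
  - by move=> p /SP[pp Tp _ pK]; rewrite mem_filter Tp mem_primes_upto pp.
  by move=> p; rewrite mulr_ge0 ?nlog_ge0 ?invr_ge0 ?ler0n.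
have b0 : 0 <= a + D%:R * l by rewrite -lMM nlog_ge0.
have total : D%:R * (K%:R * l - K%:R) <=
    11/10 * (D%:R * K%:R * (l / 2 + C)) + (prime_count K)%:R * (D%:R * (a + D%:R * l))
    + (size Q)%:R * (D%:R * (a + D%:R * l)).
  apply: (le_trans s1); apply: (le_trans s2).
  rewrite (bigID (fun p => p <= K)%N) /=; apply: lerD; rewrite -[X in X <= _]big_filter; last first.
    have -> : [seq i <- PP | ~~ (i <= K)%N] = Q by apply: eq_filter => p; rewrite ltnNge.
    rewrite mulr_natl -[X in _ <= X]addr0 -iter_addr -[size _](count_predT) -big_const_seq.
    by rewrite big_seq [X in _ <= X]big_seq; apply: ler_sum => p /sQ.
  rewrite -/S; apply: (@le_trans _ _ (\sum_(p <- S)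
     (11/10 * (D%:R * K%:R * (nlog R p / p%:R)) + D%:R * (a + D%:R * l)))).
    by rewrite big_seq [X in _ <= X]big_seq; apply: ler_sum => p /sS.
  rewrite big_split /= -!mulr_sumr; apply: lerD.
    by rewrite ler_pM2l ?ler_wpM2l ?mulr_ge0 ?ler0n //; lra.
  rewrite big_const_seq count_predT iter_addr addr0 mulrnAr -[X in X <= _]mulr_natl.
  by rewrite ler_wpM2r ?ler_nat ?mulr_ge0 ?ler0n.
have D1 : 1 <= D%:R :> R by rewrite ler1n.
have pcK : (prime_count K)%:R <= K%:R :> R by rewrite ler_nat prime_count_le.
have pcl := prime_count_nlog R K; rewrite -/l in pcl.
have K1 : 1 <= K%:R :> R by rewrite ler1n.
have := count_from_log_inequality D1 K1 a0 (ler0n R (size Q)) (ler0n R (prime_count K)) pcK pcl lL total.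
by rewrite natr1 -!natrM ler_nat.
Qed.

(** * Primes with two close roots *)

(** The binary form y ^ deg(g) g(x / y). *)
Definition homogenize (g : {poly int}) (x y : int) : int :=
  \sum_(i < size g) g`_i * (x ^+ i * y ^+ ((size g).-1 - i)).

Lemma homogenizeE (K : fieldType) (g : {poly int}) (x y : int) : y%:~R != 0 :> K ->
  (homogenize g x y)%:~R = y%:~R ^+ (size g).-1 * (map_poly intr g).[x%:~R / y%:~R] :> K.
Proof.
move=> y0; rewrite (horner_coef_wide _ (size_poly _ _)) /homogenize rmorph_sum mulr_sumr.
apply: eq_bigr => i _; rewrite coef_map !rmorphM !rmorphXn /= expr_div_n.
have -> : y%:~R ^+ (size g).-1 = y%:~R ^+ ((size g).-1 - i) * y%:~R ^+ i :> K.
  by rewrite -exprD subnK // -ltnS prednK // (leq_ltn_trans _ (ltn_ord i)).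
by move: (y%:~R ^+ i) (expf_neq0 i y0) => z z0; field.
Qed.

Lemma homogenize_bound (g : {poly int}) : exists2 C0 : nat, (0 < C0)%N &
  forall x y B, `|x| <= B%:Z -> `|y| <= B%:Z ->
    (`|homogenize g x y| <= C0 * B ^ (size g).-1)%N.
Proof.
pose A := \sum_(i < size g) `|g`_i|.
have A0 : 0 <= A by apply: sumr_ge0.
exists `|A|.+1 => // x y B xB yB; rewrite -lez_nat abszE.
apply: (le_trans (ler_norm_sum _ _ _)).
apply: (@le_trans _ _ (A * (B ^ (size g).-1)%:Z)); last first.
  by rewrite PoszM ler_wpM2r //; move: A0; clear; case: A => //= a _; lia.
rewrite /A mulr_suml; apply: ler_sum => i _; rewrite normrM ler_wpM2l //.
rewrite normrM !normrX -(subnK (_ : i <= (size g).-1)%N); last first.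
  by rewrite -ltnS prednK // (leq_ltn_trans _ (ltn_ord i)).
by rewrite addnK PoszX exprD mulrC; apply: ler_pM; rewrite ?exprn_ge0 // lerXn2r ?nnegrE.
Qed.

Lemma homogenize_eq0 (g : {poly int}) x y :
  g \is monic -> (1 < size g)%N -> no_rat_root g -> homogenize g x y = 0 -> x = 0 /\ y = 0.
Proof.
move=> gm sg nr h; have [y0|y0] := eqVneq y 0.
  split=> //; move: h; have lt : ((size g).-1 < size g)%N by rewrite prednK // ltnW.
  rewrite /homogenize (bigD1 (Ordinal lt)) //= big1 ?addr0; last first.
    move=> i; rewrite -val_eqE /= => ne; have := ltn_ord i.
    rewrite y0 -{2}(prednK (ltnW sg)) ltnS leq_eqVlt (negPf ne) /= => ilt.
    by rewrite expr0n subn_eq0 leqNgt ilt !mulr0.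
  by rewrite -lead_coefE (monicP gm) mul1r subnn mulr1 => /eqP; rewrite expf_eq0 => /andP[_ /eqP].
have y1 : y%:~R != 0 :> rat by rewrite intr_eq0.
have := homogenizeE g x y1; rewrite h => /esym/eqP; rewrite mulf_eq0 expf_eq0 (negPf y1) andbF /=.
by move=> r; have := nr (x%:~R / y%:~R); rewrite rootE r.
Qed.

Definition roots_mod (g : {poly int}) (p : nat) : seq 'F_p :=
  enum [pred r : 'F_p | root (map_poly intr g) r].

Definition split_mod (g : {poly int}) (p : nat) : bool := size (roots_mod g p) == (size g).-1.

(** If p does not divide y, only r = x / y can count, and it is a root of g. If p divides y and some
    r counts, then p divides x too, and p ^ deg(g) divides the form, which pays for all the roots at
    once. *)
Lemma split_mod_homogenize (g : {poly int}) p : prime p -> split_mod g p ->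
  let rs := [seq (nat_of_ord r)%:Z | r <- roots_mod g p] in
  size rs = (size g).-1 /\ forall x y, homogenize g x y != 0 ->
    (count (fun r => (p%:Z %| (x - r * y)%R)%Z) rs <= logn p `|homogenize g x y|)%N.
Proof.
move=> pp /eqP sp rs; split; first by rewrite size_map.
move=> x y h0; have dv (z : int) : (p%:Z %| z)%Z = (z%:~R == 0 :> 'F_p).
  by apply: dvdz_pcharf; apply: pchar_Fp.
have vE (r : 'F_p) : ((nat_of_ord r)%:Z)%:~R = r by rewrite -[RHS]natr_Zp.
have [py|npy] := boolP (p%:Z %| y)%Z.
  have [hs|] := boolP (has (fun r => (p%:Z %| (x - r * y)%R)%Z) rs); last first.
    by rewrite has_count -leqNgt leqn0 => /eqP->.
  have px : (p%:Z %| x)%Z.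
    case/hasP: hs => r _ h; rewrite -[x](subrK (r * y)).
    by apply: rpredD => //; apply: dvdz_mull.
  apply: (leq_trans (count_size _ _)); rewrite size_map sp.
  rewrite -pfactor_dvdn ?absz_gt0 //.
  suff : ((p ^ (size g).-1)%:Z %| homogenize g x y)%Z by rewrite dvdzE.
  apply: rpred_sum => i _; apply: dvdz_mull.
  have e : ((size g).-1 = i + ((size g).-1 - i))%N.
    by rewrite subnKC // -ltnS prednK // (leq_ltn_trans _ (ltn_ord i)).
  have -> : (p ^ (size g).-1)%:Z = p%:Z ^+ i * p%:Z ^+ ((size g).-1 - i).
    by rewrite -exprD -e PoszX.
  by apply: dvdz_mul; apply: dvdz_exp2r.
have y0 : y%:~R != 0 :> 'F_p by rewrite -dv.
have e (r : 'F_p) : (p%:Z %| (x - (nat_of_ord r)%:Z * y)%R)%Z = (r == x%:~R / y%:~R).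
  rewrite dv intrB intrM vE subr_eq0 eq_sym -(inj_eq (mulIf (invr_neq0 y0))).
  by rewrite mulfK.
rewrite count_map (eq_count (a2 := pred1 (x%:~R / y%:~R))); last by move=> r /=; rewrite e.
rewrite count_uniq_mem ?enum_uniq //; case: (boolP (_ \in _)) => //=.
rewrite mem_enum inE => /eqP rt; rewrite -pfactor_dvdn ?absz_gt0 // expn1.
suff : (p%:Z %| homogenize g x y)%Z by rewrite dvdzE.
by rewrite dv homogenizeE // rt mulr0.
Qed.

(** A prime exceeding the denominator leaves it invertible, so the root reduces modulo p; the
    homogenized form carries the equation over the integers. *)
Lemma has_root_mod_of_rat_root (f : {poly int}) (x : rat) :
  root (map_poly intr f) x -> exists v : nat, forall p, prime p -> (v < p)%N -> has_root_mod f p.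
Proof.
move=> rx; exists `|denq x|%N => p pp vp.
have dv (z : int) : (p%:Z %| z)%Z = (z%:~R == 0 :> 'F_p).
  by apply: dvdz_pcharf; apply: pchar_Fp.
have q0 : (denq x)%:~R != 0 :> rat by rewrite intr_eq0 denq_neq0.
have h0 : homogenize f (numq x) (denq x) = 0.
  apply/eqP; rewrite -(intr_eq0 rat) homogenizeE // divq_num_den.
  by rewrite (eqP rx) mulr0.
have qp : (denq x)%:~R != 0 :> 'F_p.
  rewrite -dv; apply/negP; rewrite dvdzE => /dvdn_leq; rewrite absz_gt0 denq_neq0.
  by move=> /(_ isT); rewrite leqNgt vp.
have := homogenizeE f (numq x) qp; rewrite h0 => /esym/eqP.
rewrite mulf_eq0 expf_eq0 (negPf qp) andbF /=; set r : 'F_p := _ / _ => rt.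
exists (nat_of_ord r); rewrite dv -horner_map /=.
by have -> : ((nat_of_ord r)%:Z)%:~R = r by rewrite -[RHS]natr_Zp.
Qed.

(** [g] is a monic model of f through y = s x + b, under which a difference dd * t between roots of
    f becomes s * dd * t. The prime divisors of [H.[t]] realize this difference, so those supplied
    by [large_prime_divisors] can play the part of [Q]. *)
Lemma block_of_depressed (f g H : {poly int}) (s b u : int) (n dd : nat) :
    g \is monic -> size g = n.+2 -> (0 < n <= 2)%N -> no_rat_root g ->
    s != 0 -> u != 0 -> (0 < dd)%N ->
    (forall x : int, u * f.[x] = g.[s * x + b]) ->
    (1 < size H)%N ->
    (forall t : nat, (0 < t)%N -> (t ^ (size H).-1 <= `|H.[t%:Z]|)%N) ->
    (forall t p : nat, (0 < t)%N -> prime p -> (p%:Z %| H.[t%:Z])%Z ->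
       [/\ split_mod g p, (11 <= p)%N, ~~ (p%:Z %| H^`().[t%:Z])%Z, ~~ (p%:Z %| s * u)%Z
         & exists y : 'F_p, root (map_poly intr g) y &&
             root (map_poly intr g) (y + (s * (dd * t)%:Z)%:~R)]) ->
  exists G, forall k, (G <= k)%N -> exists m, block_prop f k m.
Proof.
move=> gm sg n02 nr s0 u0 dd0 fg szH Hlow Hp.
pose R := (Rdefinitions.R : realType).
have lift p (y : 'F_p) : prime p -> ~~ (p%:Z %| s * u)%Z -> root (map_poly intr g) y ->
    exists r : nat, (s * r%:Z + b)%:~R = y /\ (p%:Z %| f.[r%:Z])%Z.
  move=> pp psu ry.
  have dv (z : int) : (p%:Z %| z)%Z = (z%:~R == 0 :> 'F_p).
    by apply: dvdz_pcharf; apply: pchar_Fp.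
  move: psu; rewrite dv rmorphM /= mulf_eq0 negb_or => /andP[ps pu].
  pose r : 'F_p := (y - b%:~R) / s%:~R.
  have rE : ((nat_of_ord r)%:Z)%:~R = r by rewrite -[RHS]natr_Zp.
  have e : (s * (nat_of_ord r)%:Z + b)%:~R = y.
    by rewrite rmorphD rmorphM /= rE /r mulrC divfK // subrK.
  exists (nat_of_ord r); split=> //.
  rewrite dv -(inj_eq (mulfI pu)) mulr0 -rmorphM fg -horner_map /= e; exact: ry.
have [C HC] : exists C : R, forall x, (0 < x)%N ->
    \sum_(p <- primes_upto x | split_mod g p) nlog R p / p%:R <= nlog R x / 2 + C.
  have [C0 C00 HC0] := homogenize_bound g.
  apply: (split_primes_nlog_sum R (F := homogenize g) (d := (size g).-1) (C0 := C0)
    (rs := fun p => [seq (nat_of_ord r)%:Z | r <- roots_mod g p])) => //.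
  - by rewrite sg.
  - by move=> x y; apply: homogenize_eq0; rewrite ?sg.
  by move=> p pp sp; apply: split_mod_homogenize.
have [|c [K0 HK]] := @large_prime_divisors R H (split_mod g) szH (ex_intro _ C HC) Hlow.
  by move=> t p t0 pp /(Hp t p t0 pp)[].
(* The sieving factor must beat k / size Q, where k < 2 dd (K + 1) <= 4 dd K and K <= c * size Q.
   Primes above |s u| leave s and u invertible. *)
have [S1 [uS1 pS1 hS1 E1]] := sieving_rooted gm sg n02 nr `|(s * u)%R|%N (6 * c.+1 * dd).
pose M := \max_(p <- S1) p.
have S1M p : p \in S1 -> (p <= M)%N by move=> pS; apply: (leq_bigmax_seq _ pS).
(* K > M keeps [S1] disjoint from [Q], whose primes exceed K; and t <= K makes the distance dd * t
   at most k / 2. *)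
exists (2 * dd * (K0 + M + 1))%N => k kG.
pose K := (k %/ (2 * dd))%N.
have KK : (K0 + M + 1 <= K)%N by rewrite leq_divRL ?muln_gt0 // mulnC.
have Kk : (K * (2 * dd) <= k)%N := leq_trunc_div _ _.
have kK : (k < K.+1 * (2 * dd))%N by apply: ltn_ceil; rewrite muln_gt0.
have [|Q [uQ pQ hQ sQ]] := HK K; first by apply: leq_trans KK; rewrite -addnA leq_addr.
have QP q : q \in Q -> prime q by apply: (allP pQ).
apply: (@block_of_classes f k [::] S1 Q) => /=.
- rewrite cat_uniq uS1 uQ andbT; apply/hasPn => q /hQ[Kq _]; apply/negP => /S1M qM.
  by move: (leq_trans Kq qM) KK; clear; lia.
- by rewrite all_cat pS1.
- move=> p pS; have [sup /existsP[y ry]] := hS1 p pS.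
  have pp := allP pS1 p pS.
  have nd : ~~ (p%:Z %| s * u)%Z.
    apply/negP; rewrite dvdzE => /dvdn_leq; rewrite absz_gt0 mulf_neq0 // => /(_ isT).
    by rewrite leqNgt sup.
  split; first by have [r [_ hr]] := lift p y pp nd ry; exists r.
  by have := S1M p pS; move: KK Kk dd0; clear; nia.
- move=> q qQ; have [_ [t [/andP[t0 tK] qH]]] := hQ q qQ; have qp := QP q qQ.
  have [_ _ _ nd [y /andP[r1 r2]]] := Hp t q t0 qp qH.
  have [r [er hr]] := lift q y qp nd r1.
  exists r, (dd * t)%N; split=> //.
  + by rewrite muln_gt0 dd0.
  + by apply: leq_trans Kk; move: tK; clear; nia.
  have dv (z : int) : (q%:Z %| z)%Z = (z%:~R == 0 :> 'F_q).
    by apply: dvdz_pcharf; apply: pchar_Fp.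
  have pu : u%:~R != 0 :> 'F_q.
    by move: nd; rewrite dv rmorphM /= mulf_eq0 negb_or => /andP[].
  rewrite dv -(inj_eq (mulfI pu)) mulr0 -rmorphM fg -horner_map /=.
  have -> : s * (r + dd * t)%:Z + b = (s * r%:Z + b) + s * (dd * t)%:Z by rewrite PoszD; ring.
  by rewrite rmorphD /= er; exact: r2.
rewrite filter_predT size_iota.
apply: (@leq_trans (6 * c.+1 * dd * size Q * \prod_(p <- S1) p.-1)%N).
  rewrite leq_mul2r; apply/orP; right.
  by move: kK sQ KK dd0; clear; move: (size Q) => z; nia.
by rewrite mulnAC mulnC leq_mul2l E1 orbT.
Qed.

(** * Quadratic and cubic polynomials *)

Lemma prime_ge11 p : prime p -> ~~ (p %| 210)%N -> (11 <= p)%N.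
Proof. by move=> pp; rewrite leqNgt; apply: contra; move: pp; do 11![case: p => [|p] //]. Qed.

Lemma split_mod_of_roots (g : {poly int}) p (rs : seq 'F_p) :
    prime p -> g \is monic -> uniq rs -> all (root (map_poly intr g)) rs ->
    size rs = (size g).-1 ->
  split_mod g p.
Proof.
move=> pp gm urs ars srs; rewrite /split_mod eqn_leq -{2}srs; apply/andP; split.
  have gp0 : map_poly intr g != 0 :> {poly 'F_p} by apply: monic_neq0; apply: monic_map.
  rewrite -ltnS prednK ?size_poly_gt0 ?monic_neq0 //.
  apply: leq_trans (size_poly _ _ : size (map_poly intr g : {poly 'F_p}) <= size g)%N.
  apply: max_poly_roots => //; last exact: enum_uniq.
  by apply/allP => x; rewrite mem_enum.
by apply: uniq_leq_size => // x /(allP ars) rx; rewrite mem_enum.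
Qed.

(** If y, y + e, z are roots with sum 0, then y = -(z + e) / 2 and (e ^ 2 + P) z = 3 Q, whence the
    witnesses. Moreover e (e ^ 2 + 3 P) is, up to sign, the product of the root differences, so the
    hypothesis is the discriminant relation. *)
Lemma depressed_cubic_roots (K : fieldType) (e P Q : K) :
    2 != 0 :> K -> Q != 0 -> e != 0 -> e ^+ 2 + 3 * P != 0 -> 27 != 0 :> K ->
    (e * (e ^+ 2 + 3 * P)) ^+ 2 = - (4 * P ^+ 3 + 27 * Q ^+ 2) ->
  e ^+ 2 + P != 0 /\ exists y z : K,
    [/\ y ^+ 3 + P * y + Q = 0, (y + e) ^+ 3 + P * (y + e) + Q = 0,
        z ^+ 3 + P * z + Q = 0 & uniq [:: y; y + e; z]].
Proof.
move=> n2 Q0 e0 w0 n27 rel; set A := e ^+ 2 + P.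
(* (e (e ^ 2 + 3 P)) ^ 2 + 4 P ^ 3 factors as A ^ 2 (e ^ 2 + 4 P). *)
have rel' : 27 * Q ^+ 2 + A ^+ 2 * (e ^+ 2 + 4 * P) = 0.
  by rewrite /A; move/eqP: rel; rewrite -subr_eq0 => /eqP <-; ring.
have A0 : A != 0.
  apply/eqP => a0; move/eqP: rel'; rewrite a0 expr0n mul0r addr0 mulf_eq0 expf_eq0.
  by rewrite (negPf n27) (negPf Q0).
split=> //; exists (- (e * A + 3 * Q) / (2 * A)), (3 * Q / A).
have c0 : 2 * A != 0 by rewrite mulf_neq0.
have PE : P = A - e ^+ 2 by rewrite /A; ring.
move: rel' w0 A0 c0; rewrite PE; clearbody A => rel' w0 A0 c0.
set y := _ / (2 * A); set z := _ / A.
have ye : y + e = (e * A - 3 * Q) / (2 * A) by rewrite /y; field; rewrite A0 n2.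
have n8 : (2 * A) ^+ 3 != 0 by rewrite expf_neq0.
split.
- apply: (mulfI n8); rewrite mulr0 -[RHS](mulr0 (- (e * A + Q))) -[in RHS]rel' /y.
  by field; rewrite A0 n2.
- apply: (mulfI n8); rewrite mulr0 -[RHS](mulr0 (e * A - Q)) -[in RHS]rel' ye.
  by field; rewrite A0 n2.
- have n3 : A ^+ 3 != 0 by rewrite expf_neq0.
  apply: (mulfI n3); rewrite mulr0 -[RHS](mulr0 Q) -[in RHS]rel' /z.
  by field.
(* The two factors are 2 A (z - y) and 2 A (y + e - z), so this separates z from both other
   roots. *)
have prod : (e * A + 9 * Q) * (e * A - 9 * Q) != 0.
  have -> : (e * A + 9 * Q) * (e * A - 9 * Q) = (2 * A) ^+ 2 * (e ^+ 2 + 3 * (A - e ^+ 2))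
      - 3 * (27 * Q ^+ 2 + A ^+ 2 * (e ^+ 2 + 4 * (A - e ^+ 2))) by ring.
  by rewrite rel' mulr0 subr0 mulf_neq0 ?expf_neq0.
rewrite /= !inE negb_or andbT -andbA; apply/and3P; split.
- by rewrite -subr_eq0 opprD addNKr oppr_eq0.
- apply: contraNneq prod => yz; have -> : e * A + 9 * Q = 2 * A * (z - y).
    by rewrite /z /y; field; rewrite A0 n2.
  by rewrite yz subrr mulr0 mul0r.
- apply: contraNneq prod => yz; have -> : e * A - 9 * Q = 2 * A * (y + e - z).
    by rewrite /z ye; field; rewrite A0 n2.
  by rewrite yz subrr !mulr0.
Qed.

Lemma map_horner_deg2 (K : comNzRingType) (f : {poly int}) (x : K) : (size f <= 3)%N ->
  (map_poly intr f).[x] = (f`_2)%:~R * x ^+ 2 + (f`_1)%:~R * x + (f`_0)%:~R.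
Proof.
move=> sf; rewrite (horner_coef_wide _ (leq_trans (size_poly _ _) sf)).
by rewrite !big_ord_recr big_ord0 /= !coef_map /=; ring.
Qed.

Lemma map_horner_deg3 (K : comNzRingType) (f : {poly int}) (x : K) : (size f <= 4)%N ->
  (map_poly intr f).[x] =
    (f`_3)%:~R * x ^+ 3 + (f`_2)%:~R * x ^+ 2 + (f`_1)%:~R * x + (f`_0)%:~R.
Proof.
move=> sf; rewrite (horner_coef_wide _ (leq_trans (size_poly _ _) sf)).
by rewrite !big_ord_recr big_ord0 /= !coef_map /=; ring.
Qed.

Lemma map_poly_intr_int (g : {poly int}) (x : int) : (map_poly intr g).[x] = g.[x].
Proof. by have := horner_map (intr : int -> int) g x; rewrite /= !intz. Qed.

(** Completing the square, 4 a f(x) = (2 a x + b) ^ 2 - E. The roots of g are opposite, so a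
    difference [dl] is realized by -dl/2 and dl/2 as soon as dl ^ 2 = 4 E modulo p. *)
Lemma block_of_quadratic (f : {poly int}) : size f = 3%N -> no_rat_root f ->
  exists G, forall k, (G <= k)%N -> exists m, block_prop f k m.
Proof.
move=> sf nr; set a := f`_2; set b := f`_1; set c := f`_0.
have a0 : a != 0 by have := lead_coef_eq0 f; rewrite lead_coefE -size_poly_eq0 sf /= => ->.
pose E := b ^+ 2 - 4 * a * c.
pose s := 2 * a.
pose g : {poly int} := Poly [:: - E; 0; 1].
have sg : size g = 3%N by rewrite (PolyK (c := 0)).
have gm : g \is monic by rewrite monicE lead_coefE sg /g (PolyK (c := 0)).
have gE (K : comNzRingType) (x : K) : (map_poly intr g).[x] = x ^+ 2 - E%:~R.
  rewrite map_horner_deg2 ?sg // /g (PolyK (c := 0)) //=; ring.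
have fE (K : comNzRingType) (x : K) :
    (4 * a)%:~R * (map_poly intr f).[x] = (map_poly intr g).[s%:~R * x + b%:~R].
  by rewrite gE map_horner_deg2 ?sf // /E /s -/a -/b -/c; ring.
have a4 : (4 * a)%:~R != 0 :> rat by rewrite intr_eq0 mulf_neq0.
have s0 : s != 0 by rewrite mulf_neq0.
have nrg : no_rat_root g.
  move=> y; apply/negP => /eqP ry; have := nr ((y - b%:~R) / s%:~R); rewrite rootE => /negP; apply.
  rewrite -(inj_eq (mulfI a4)) mulr0 fE mulrC divfK ?subrK ?ry //.
  by rewrite intr_eq0.
have E0 : E != 0.
  by apply/eqP => e0; have := nrg 0; rewrite rootE gE e0 expr0n subrr eqxx.
(* For [e := s * 840 * `|E| * t], [e ^+ 2 - 4 * E = 4 * E * H.[t]]; the spare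
   factors make [H] equal to -1 modulo every bad prime. *)
pose w := s ^+ 2 * 420 ^+ 2 * E.
pose H : {poly int} := Poly [:: -1; 0; w].
have w0 : w != 0 by rewrite /w !mulf_neq0 ?expf_neq0.
have sH : size H = 3%N by rewrite (PolyK (c := 0)).
have HE x : H.[x] = w * x ^+ 2 - 1 by rewrite horner_Poly /=; ring.
have H'E x : H^`().[x] = 2 * w * x.
  rewrite /H /= !cons_poly_def !(derivD, derivM, derivX, derivC, deriv0).
  by rewrite !(hornerD, hornerM, hornerX, hornerC); ring.
apply: (@block_of_depressed f g H s b (4 * a) 1 (840 * `|E|)%N) => //.
- by rewrite mulf_neq0.
- by rewrite muln_gt0 absz_gt0.
- by move=> x; have := fE int x; rewrite !map_poly_intr_int !intz.
- by rewrite sH.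
- move=> t t0; rewrite sH HE /= -lez_nat abszE PoszX.
  have w2 : 2 <= `|w|.
    have hE : 1 <= `|E| by rewrite -gtz0_ge1 normr_gt0.
    have hs : 1 <= s ^+ 2 by rewrite -gtz0_ge1 exprn_even_gt0.
    rewrite /w normrM ger0_norm; last by move: hs; move: (s ^+ 2) => S; nia.
    by move: hs hE; move: (s ^+ 2) `|E| => S e; nia.
  have x2 : 1 <= t%:Z ^+ 2 by rewrite exprn_ege1.
  have := lerB_dist (w * t%:Z ^+ 2) 1; rewrite normrM normr1 (ger0_norm (x := _ ^+ 2)) ?exprn_ge0 //.
  have : 2 * t%:Z ^+ 2 <= `|w| * t%:Z ^+ 2 by rewrite ler_wpM2r // exprn_ge0.
  by move: x2; clear => h1 h2 h3; lra.
move=> t p t0 pp; rewrite HE => pH.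
have dv (z : int) : (p%:Z %| z)%Z = (z%:~R == 0 :> 'F_p).
  by apply: dvdz_pcharf; apply: pchar_Fp.
have wt : w%:~R * t%:R ^+ 2 = 1 :> 'F_p.
  by move: pH; rewrite dv rmorphB rmorphM rmorphXn /= rmorph1 subr_eq0 => /eqP.
have w1 : w%:~R != 0 :> 'F_p.
  by apply/eqP => h; move/eqP: wt; rewrite h mul0r eq_sym oner_eq0.
have t1 : t%:R != 0 :> 'F_p.
  by apply/eqP => h; move/eqP: wt; rewrite h expr0n mulr0 eq_sym oner_eq0.
have nz z q : w = q * z -> z%:~R != 0 :> 'F_p.
  by move=> e; apply: contraNneq w1 => h; rewrite e intrM h mulr0.
have E1 : E%:~R != 0 :> 'F_p by apply: (nz E (s ^+ 2 * 420 ^+ 2)).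
have a1 : a%:~R != 0 :> 'F_p by apply: (nz a (2 * s * 420 ^+ 2 * E)); rewrite /w /s; ring.
have p11 : (11 <= p)%N.
  apply: prime_ge11 => //; suff : ~~ (p%:Z %| 210%:Z)%Z by [].
  by rewrite dv; apply: (nz 210%:Z (s ^+ 2 * 2 * 420 * E)); rewrite /w; ring.
have n2 : 2 != 0 :> 'F_p by apply: (nz 2 (s ^+ 2 * 210 * 420 * E)); rewrite /w; ring.
have n4 : 4 != 0 :> 'F_p by apply: (nz 4 (s ^+ 2 * 105 * 420 * E)); rewrite /w; ring.
set dl : 'F_p := (s * (840 * `|E| * t)%:Z)%:~R.
have dl2 : dl ^+ 2 = 4 * E%:~R.
  have -> : 4 * E%:~R = 4 * E%:~R * (w%:~R * t%:R ^+ 2) :> 'F_p by rewrite wt mulr1.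
  rewrite -[t%:R]/((t%:Z)%:~R) -[4]/((4%:Z)%:~R) -rmorphXn /= -!rmorphXn -!rmorphM /=.
  congr (_%:~R); rewrite /w !PoszM !exprMn abszE.
  by rewrite real_normK ?num_real //; ring.
have dl0 : dl != 0.
  apply/eqP => h; move/eqP: dl2; rewrite h expr0n eq_sym mulf_eq0 (negPf E1) orbF.
  by rewrite (negPf n4).
have r1 : root (map_poly intr g) (- (dl / 2)).
  rewrite rootE gE -(inj_eq (mulfI (mulf_neq0 n2 n2))) mulr0.
  have -> : 2 * 2 * ((- (dl / 2)) ^+ 2 - E%:~R) = dl ^+ 2 - 4 * E%:~R :> 'F_p by field.
  by rewrite dl2 subrr.
have e2 : - (dl / 2) + dl = dl / 2 by field.
have r2 : root (map_poly intr g) (- (dl / 2) + dl).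
  by move: r1; rewrite e2 !rootE !gE sqrrN.
split=> //.
- apply: (split_mod_of_roots (rs := [:: - (dl / 2); - (dl / 2) + dl])) => //=.
  + by rewrite inE andbT -subr_eq0 opprD addNKr oppr_eq0.
  + by rewrite r1 r2.
  by rewrite sg.
- rewrite H'E dv 2!intrM; apply: mulf_neq0; last exact: t1.
  by apply: mulf_neq0; first exact: n2.
- by rewrite dv /s 3!intrM; apply: mulf_neq0; apply: mulf_neq0.
by exists (- (dl / 2)); rewrite r1 /= -/dl r2.
Qed.

Lemma sqr_scaled_abs (s E : int) (m t : nat) :
  (s * (`|E| * m * t)%:Z) ^+ 2 = (s * E * m%:Z * t%:Z) ^+ 2.
Proof. by rewrite !PoszM !exprMn abszE real_normK ?num_real //; ring. Qed.

Lemma horner_even_sextic (c2 c4 c6 x : int) :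
  (Poly [:: -1; 0; c2; 0; c4; 0; c6]).[x] = c6 * x ^+ 6 + c4 * x ^+ 4 + c2 * x ^+ 2 - 1.
Proof. by rewrite horner_Poly /=; ring. Qed.

Lemma horner_deriv_even_sextic (c2 c4 c6 x : int) :
  (Poly [:: -1; 0; c2; 0; c4; 0; c6])^`().[x] =
    6 * c6 * x ^+ 5 + 4 * c4 * x ^+ 3 + 2 * c2 * x.
Proof.
rewrite /= !cons_poly_def !(derivD, derivM, derivX, derivC, deriv0).
by rewrite !(hornerD, hornerM, hornerX, hornerC); ring.
Qed.

(** For k = s M and q = s E M, the coefficient list that fixes the size of H turns into E h ^ 2 - 1,
    the form carrying the discriminant relation. *)
Lemma sextic_square (E k q P x : int) :
  E * k ^+ 2 * q ^+ 4 * x ^+ 6 + E * k ^+ 2 * 6 * P * q ^+ 2 * x ^+ 4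
    + E * k ^+ 2 * 9 * P ^+ 2 * x ^+ 2 - 1 =
  E * (k * x * ((q * x) ^+ 2 + 3 * P)) ^+ 2 - 1.
Proof. by ring. Qed.

(** The last factor contains e ^ 2 + P, which [depressed_cubic_roots] shows to be nonzero modulo p;
    hence the roots of H are simple. *)
Lemma sextic_square_deriv (E k q P x : int) :
  6 * (E * k ^+ 2 * q ^+ 4) * x ^+ 5 + 4 * (E * k ^+ 2 * 6 * P * q ^+ 2) * x ^+ 3
    + 2 * (E * k ^+ 2 * 9 * P ^+ 2) * x =
  2 * E * (k * x * ((q * x) ^+ 2 + 3 * P)) * (3 * k * ((q * x) ^+ 2 + P)).
Proof. by ring. Qed.

(** The size of [M] absorbs 3 P, so the inner bracket is at least t ^ 2; with M >= 2 this gives h ^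
    2 >= 2 t ^ 6, which leaves room for the -1. *)
Lemma sextic_lower (E s M P t : int) :
    E != 0 -> s != 0 -> 2 * (3 * `|P| + 1) <= M -> 1 <= t ->
  t ^+ 6 <= `|E * (s * M * t * ((s * E * M * t) ^+ 2 + 3 * P)) ^+ 2 - 1|.
Proof.
move=> E0 s0 PM t1; set h := s * M * t * _.
have sq (z : int) : z != 0 -> 1 <= z ^+ 2 by move=> z0; rewrite -gtz0_ge1 exprn_even_gt0.
have P1 := normr_ge0 P; have P2 : - `|P| <= P by rewrite lerNnormlW.
have t0 : 0 <= t := le_trans ler01 t1.
have t2 : 1 <= t ^+ 2 by rewrite exprn_ege1.
have M1 : 3 * `|P| + 1 <= M ^+ 2.
  apply: (@le_trans _ _ (M * 1)); first lia.
  by rewrite expr2 ler_wpM2l; lia.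
have w1 : t ^+ 2 <= (s * E * M * t) ^+ 2 + 3 * P.
  have h1 : M ^+ 2 * t ^+ 2 <= (s * E * M * t) ^+ 2.
    have -> : (s * E * M * t) ^+ 2 = (s * E) ^+ 2 * (M ^+ 2 * t ^+ 2) by ring.
    rewrite ler_peMl //; first by rewrite mulr_ge0 ?sqr_ge0.
    by apply: sq; rewrite mulf_neq0.
  have h2 : (3 * `|P| + 1) * t ^+ 2 <= M ^+ 2 * t ^+ 2 by rewrite ler_wpM2r ?sqr_ge0.
  have h3 : `|P| * 1 <= `|P| * t ^+ 2 by rewrite ler_wpM2l.
  lra.
have h1 : 2 * t ^+ 6 <= h ^+ 2.
  rewrite /h exprMn.
  have -> : 2 * t ^+ 6 = (2 * t ^+ 2) * (t ^+ 2) ^+ 2 by ring.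
  apply: ler_pM; rewrite ?mulr_ge0 ?sqr_ge0 //; last first.
    by rewrite lerXn2r ?nnegrE ?sqr_ge0 // (le_trans _ w1) ?sqr_ge0.
  rewrite exprMn ler_wpM2r ?sqr_ge0 // exprMn.
  have s1 := sq s s0; have M2 : 2 <= M by clear -PM P1; lia.
  apply: (@le_trans _ _ (1 * M ^+ 2)); last by rewrite ler_wpM2r ?sqr_ge0.
  by rewrite mul1r expr2; nia.
have e1 : 1 <= `|E| by rewrite -gtz0_ge1 normr_gt0.
have t6 : 1 <= t ^+ 6 by rewrite exprn_ege1.
have h2 : h ^+ 2 <= `|E| * h ^+ 2 by rewrite ler_peMl ?sqr_ge0.
have := lerB_dist (E * h ^+ 2) 1; rewrite normrM normr1 [`|h ^+ 2|]ger0_norm ?sqr_ge0 //.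
by move: h1 t6 h2; clear => *; lra.
Qed.

(** The substitution y = 3 a x + b removes the quadratic term: 27 a ^ 2 f(x) = y ^ 3 + P y + Q, of
    discriminant E. *)
Lemma block_of_cubic (f : {poly int}) : size f = 4%N -> no_rat_root f ->
  exists G, forall k, (G <= k)%N -> exists m, block_prop f k m.
Proof.
move=> sf nr; set a := f`_3; set b := f`_2; set c := f`_1; set e := f`_0.
have a0 : a != 0 by have := lead_coef_eq0 f; rewrite lead_coefE -size_poly_eq0 sf /= => ->.
pose P := 9 * a * c - 3 * b ^+ 2.
pose Q := 27 * a ^+ 2 * e - 9 * a * b * c + 2 * b ^+ 3.
pose E := - (4 * P ^+ 3 + 27 * Q ^+ 2).
pose s := 3 * a.
pose u := 27 * a ^+ 2.
pose g : {poly int} := Poly [:: Q; P; 0; 1].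
have sg : size g = 4%N by rewrite (PolyK (c := 0)).
have gm : g \is monic by rewrite monicE lead_coefE sg /g (PolyK (c := 0)).
have gE (K : comNzRingType) (x : K) :
    (map_poly intr g).[x] = x ^+ 3 + P%:~R * x + Q%:~R.
  by rewrite map_horner_deg3 ?sg // /g (PolyK (c := 0)) //=; ring.
have fE (K : comNzRingType) (x : K) :
    u%:~R * (map_poly intr f).[x] = (map_poly intr g).[s%:~R * x + b%:~R].
  by rewrite gE map_horner_deg3 ?sf // /u /Q /P /s -/a -/b -/c -/e; ring.
have u0 : u != 0 by rewrite mulf_neq0 ?expf_neq0.
have s0 : s != 0 by rewrite mulf_neq0.
have nrg : no_rat_root g.
  move=> y; apply/negP => /eqP ry; have := nr ((y - b%:~R) / s%:~R); rewrite rootE => /negP; apply.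
  have uq : u%:~R != 0 :> rat by rewrite intr_eq0.
  rewrite -(inj_eq (mulfI uq)) mulr0 fE mulrC divfK ?subrK ?ry //.
  by rewrite intr_eq0.
have Q0 : Q != 0.
  by apply/eqP => q0; have := nrg 0; rewrite rootE gE q0 expr0n mulr0 !addr0 eqxx.
(* If the discriminant vanished, [3 * Q / P] (or 0) would be a rational root. *)
have E0 : E != 0.
  apply/eqP => e0.
  have e0' : 4 * P%:~R ^+ 3 + 27 * Q%:~R ^+ 2 = 0 :> rat.
    have : (- E)%:~R = 0 :> rat by rewrite e0 oppr0.
    by rewrite /E => <-; ring.
  have [p0|p0] := eqVneq (P%:~R : rat) 0.
    move: e0'; rewrite p0 expr0n mulr0 add0r => /eqP; rewrite mulf_eq0 expf_eq0 /= intr_eq0.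
    by rewrite (negPf Q0).
  have := nrg (3 * Q%:~R / P%:~R); rewrite rootE gE => /negP; apply; apply/eqP.
  have -> : (3 * Q%:~R / P%:~R) ^+ 3 + P%:~R * (3 * Q%:~R / P%:~R) + Q%:~R =
      Q%:~R / P%:~R ^+ 3 * (4 * P%:~R ^+ 3 + 27 * Q%:~R ^+ 2) :> rat by field.
  by rewrite e0' mulr0.
(* A difference [e] of two roots of [g] satisfies [(e * (e ^+ 2 + 3 * P)) ^+ 2 = E].
   For [e := s * `|E| * m * t] the left side minus [E] is [E * H.[t]], and [m] makes
   [H] equal to -1 modulo every bad prime. *)
pose m : nat := (210 * `|Q| * (3 * `|P| + 1))%N.
pose M : int := m%:Z.
have m0 : (0 < m)%N by rewrite !muln_gt0 absz_gt0 Q0 addn1.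
pose c2 := E * (s * M) ^+ 2 * 9 * P ^+ 2.
pose c4 := E * (s * M) ^+ 2 * 6 * P * (s * E * M) ^+ 2.
pose c6 := E * (s * M) ^+ 2 * (s * E * M) ^+ 4.
pose H : {poly int} := Poly [:: -1; 0; c2; 0; c4; 0; c6].
have M0 : M != 0 by rewrite eqz_nat -lt0n.
have c60 : c6 != 0 by rewrite !(mulf_neq0, expf_neq0).
have sH : size H = 7%N by rewrite (PolyK (c := 0)).
pose h (x : int) := s * M * x * ((s * E * M * x) ^+ 2 + 3 * P).
have HE x : H.[x] = E * h x ^+ 2 - 1 by rewrite horner_even_sextic sextic_square.
have H'E x : H^`().[x] = 2 * E * h x * (3 * (s * M) * ((s * E * M * x) ^+ 2 + P)).
  by rewrite horner_deriv_even_sextic sextic_square_deriv.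
apply: (@block_of_depressed f g H s b u 2 (`|E| * m)%N) => //.
- by rewrite muln_gt0 absz_gt0 E0.
- by move=> x; have := fE int x; rewrite !map_poly_intr_int !intz.
- by rewrite sH.
- move=> t t0; rewrite sH HE /= -lez_nat abszE PoszX.
  apply: sextic_lower => //; rewrite /M -abszE -!PoszM lez_nat.
  rewrite /m leq_mul2r; apply/orP; right.
  by apply: leq_trans (leq_pmulr _ _); rewrite // absz_gt0.
move=> t p t0 pp; rewrite HE => pH.
have dv (z : int) : (p%:Z %| z)%Z = (z%:~R == 0 :> 'F_p).
  by apply: dvdz_pcharf; apply: pchar_Fp.
have wt : E%:~R * (h t)%:~R ^+ 2 = 1 :> 'F_p.
  by move: pH; rewrite dv intrB intrM subr_eq0 => /eqP; rewrite rmorphXn.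
have E1 : E%:~R != 0 :> 'F_p.
  by apply/eqP => hh; move/eqP: wt; rewrite hh mul0r eq_sym oner_eq0.
have h1 : (h t)%:~R != 0 :> 'F_p.
  by apply/eqP => hh; move/eqP: wt; rewrite hh expr0n mulr0 eq_sym oner_eq0.
have nz z q : h t = q * z -> z%:~R != 0 :> 'F_p.
  by move=> he; apply: contraNneq h1 => hh; rewrite he intrM hh mulr0.
set W := (s * E * M * t%:Z) ^+ 2 + 3 * P in nz.
have hW : h t = s * M * t%:Z * W by [].
have W1 : W%:~R != 0 :> 'F_p by apply: (nz W _ hW).
have M1 : M%:~R != 0 :> 'F_p by apply: (nz M (s * t%:Z * W)); rewrite hW; ring.
have t1 : (t%:Z)%:~R != 0 :> 'F_p by apply: (nz t%:Z (s * M * W)); rewrite hW; ring.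
have s1 : s%:~R != 0 :> 'F_p by apply: (nz s (M * t%:Z * W)); rewrite hW; ring.
have ndm : ~~ (p %| m)%N by have := M1; rewrite -dv.
have p11 : (11 <= p)%N.
  apply: prime_ge11 => //; apply: contra ndm => hd.
  by rewrite /m -mulnA dvdn_mulr.
have Q1 : Q%:~R != 0 :> 'F_p.
  rewrite -dv; apply: contra ndm => hd; rewrite /m mulnAC dvdn_mull //.
have small (l : nat) : (0 < l < 11)%N -> (l%:Z)%:~R != 0 :> 'F_p.
  move=> /andP[l0 l11]; rewrite -dv dvdzE; apply/negP => /(dvdn_leq l0).
  by rewrite leqNgt (leq_trans l11 p11).
have n2 : 2 != 0 :> 'F_p := small 2%N isT.
have n3 : 3 != 0 :> 'F_p := small 3%N isT.
have n27 : 27 != 0 :> 'F_p.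
  by rewrite (_ : 27 = 3 ^+ 3) ?expf_neq0 // -natrX.
set dl : 'F_p := (s * (`|E| * m * t)%:Z)%:~R.
have dl2 : dl ^+ 2 = ((s * E * M * t%:Z) ^+ 2)%:~R.
  by rewrite -rmorphXn /= sqr_scaled_abs.
have dlW : dl ^+ 2 + 3 * P%:~R = W%:~R by rewrite dl2 /W; ring.
have dl0 : dl != 0.
  have : ((s * E * M * t%:Z) ^+ 2)%:~R != 0 :> 'F_p.
    by rewrite rmorphXn /= expf_neq0 // 3!intrM; do 3! (apply: mulf_neq0 => //).
  by apply: contraNneq => d0; rewrite -dl2 d0 expr0n.
(* The left side is E ^ 2 h ^ 2, and E h ^ 2 = 1 modulo p. *)
have rel : (dl * (dl ^+ 2 + 3 * P%:~R)) ^+ 2 = - (4 * P%:~R ^+ 3 + 27 * Q%:~R ^+ 2).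
  rewrite dlW exprMn dl2.
  have -> : - (4 * P%:~R ^+ 3 + 27 * Q%:~R ^+ 2) = E%:~R * (E%:~R * (h t)%:~R ^+ 2) :> 'F_p.
    by rewrite wt mulr1 /E; ring.
  by rewrite hW; ring.
have [A1 [y [z [ry ryd rz uyz]]]] :=
  depressed_cubic_roots n2 Q1 dl0 (etrans (congr1 (fun x => x != 0) dlW) W1) n27 rel.
have r1 : root (map_poly intr g) y by rewrite rootE gE ry.
have r2 : root (map_poly intr g) (y + dl) by rewrite rootE gE ryd.
have r3 : root (map_poly intr g) z by rewrite rootE gE rz.
split=> //.
- apply: (split_mod_of_roots pp gm uyz); last by rewrite sg.
  by rewrite /= r1 r2 r3.
- have A2 : ((s * E * M * t%:Z) ^+ 2 + P)%:~R != 0 :> 'F_p by rewrite intrD -dl2.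
  rewrite H'E dv !(intrM _ (2 * E * h t)) 2!intrM; apply: mulf_neq0.
    by do 2! (apply: mulf_neq0 => //).
  by rewrite 3!intrM; do 3! (apply: mulf_neq0 => //).
- have a1 : a%:~R != 0 :> 'F_p.
    by move: s1; rewrite /s intrM mulf_eq0 negb_or => /andP[].
  rewrite dv intrM; apply: mulf_neq0 => //.
  by rewrite /u intrM rmorphXn; apply: mulf_neq0; rewrite ?expf_neq0.
by exists y; rewrite r1 /= -/dl r2.
Qed.

(** X ^ 2 + 1 has no rational root, so the primes modulo which it has a root already have a
    divergent sum of inverses. *)
Lemma sieving_primes : sieving (fun=> True).
Proof.
pose g : {poly int} := Poly [:: 1; 0; 1].
have sg : size g = 3%N by rewrite (PolyK (c := 0)).
have gm : g \is monic by rewrite monicE lead_coefE sg /g (PolyK (c := 0)).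
have nr : no_rat_root g.
  move=> x; rewrite rootE map_horner_deg2 ?sg // /g (PolyK (c := 0)) //=.
  by apply/eqP; have := sqr_ge0 x; lra.
move=> P E; have [S [uS pS hS hE]] := sieving_rooted (n := 1) gm sg isT nr P E.
by exists S; split=> // p /hS[].
Qed.

Lemma eventually_block (f : {poly int}) : size f = 3%N \/ size f = 4%N ->
  exists G, forall k, (G <= k)%N -> exists m, block_prop f k m.
Proof.
move=> sf; have [nr|] := pselect (no_rat_root f).
  by case: sf => sf; [apply: block_of_quadratic | apply: block_of_cubic].
move=> /existsNP[x /negP/negPn rx].
have [v hv] := has_root_mod_of_rat_root rx.
exact: block_of_all_roots sieving_primes hv.
Qed.

Theorem theorem1p1 (f : {poly int}) :
  (size f = 3%N \/ size f = 4%N) ->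
  exists G : nat, is_Gf f G /\
    forall k : nat, (G <= k)%N ->
      forall N : nat, exists n : nat, (N <= n)%N /\ block_prop f k n.
Proof.
move=> /eventually_block[G0 hG0].
(* Admissibility is made boolean classically in order to extract the least G; [G0.+2] secures 2 <=
   G. *)
have ex : exists G, `[< Gadmissible f G >].
  by exists G0.+2; apply/asboolP; split=> // k /(leq_trans (leqW (leqnSn G0))); apply: hG0.
case: (ex_minnP ex) => G /asboolP aG minG; exists G; split.
  by split=> // G' aG'; apply: minG; apply/asboolP.
by move=> k Gk N; have [m /block_periodic] := aG.2 k Gk; apply.
Qed.
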